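(* Let $\mathcal{E}$ be an exponential family of dimension $n$ defined over a finite set $\Omega=\{x_1,\dots,x_m\}$, and let $\Phi:\mathbb{T}^n\times N\to N$ be a Kähler toric manifold with Kähler metric $g$ which is a regular torification of $\mathcal{E}$. Suppose that the estimator map $F:\Omega\to\mathbb{R}^n$ is injective. If $f$ is a Kähler function on $N$, then $$\mathrm{Crit}(f)\subseteq\mathrm{spec}(f),$$ where $\mathrm{Crit}(f)$ is the set of critical values of $f$, i.e. the set of $\lambda\in\mathbb{R}$ for which there is $p\in N$ with $f(p)=\lambda$ and $df_p=0$, and $\mathrm{spec}(f)$ is the spectrum of $f$.
   Context: Kähler toric manifolds. $\mathbb{T}^n=\mathbb{R}^n/\mathbb{Z}^n$; its Lie algebra is identified with $\mathbb{R}^n$ via the derivative at $0$ of the quotient map, and $\mathbb{R}^n$ with its dual via the Euclidean product $\langle\,,\,\rangle$. For an action $\Phi:\mathbb{T}^n\times N\to N$ write $\Phi_a(p)=\Phi(a,p)$ and $\xi_N(p)=\frac{d}{dt}\big|_0\Phi([t\xi],p)$ for $\xi\in\mathbb{R}^n$. A Kähler toric manifold is a connected compact Kähler manifold $N$ of complex dimension $n$ (metric $g$, complex structure $I$, Kähler form $\omega=g(I\cdot,\cdot)$) with an effective action $\Phi$ of $\mathbb{T}^n$ by holomorphic isometries and a momentum map $\mathbf{J}:N\to\mathbb{R}^n$, i.e. a smooth $\mathbb{T}^n$-invariant map with $\omega(\xi_N,\cdot)=d\mathbf{J}^\xi$ for all $\xi$, where $\mathbf{J}^\xi(p)=\langle\mathbf{J}(p),\xi\rangle$.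 $N^\circ$ is the (open, dense, connected) set of points where $\Phi$ is free. Exponential family. $\Omega$ carries the counting measure. $\mathcal{E}$ is the set of probability functions $p_\theta(x)=\exp\big(C(x)+\sum_{k=1}^n\theta_kF_k(x)-\psi(\theta)\big)$, $\theta\in\mathbb{R}^n$, where $C,F_1,\dots,F_n:\Omega\to\mathbb{R}$, $\psi:\mathbb{R}^n\to\mathbb{R}$, and $1,F_1,\dots,F_n$ are linearly independent; $\theta$ is a global chart of $\mathcal{E}$. $\mathbb{E}_p(X)=\sum_{x\in\Omega}X(x)p(x)$. $\mathcal{E}$ carries the Fisher metric $(h_F)_{ij}(\theta)=\mathbb{E}_{p_\theta}(\partial_i\ln p_\theta\,\partial_j\ln p_\theta)$ and the exponential connection $\nabla^{(e)}$, the flat connection for which $\theta_1,\dots,\theta_n$ are affine coordinates. The estimator map is $F=(F_1,\dots,F_n):\Omega\to\mathbb{R}^n$, and $\mathcal{A}_{\mathcal{E}}$ is the real vector space of functions on $\Omega$ spanned by $F_1,\dots,F_n,1$. Torification. With coordinates $(\theta,\dot\theta)$ on $T\mathcal{E}$ (for the tangent vector $\sum_k\dot\theta_k\partial/\partial\theta_k$ at $p_\theta$), $T\mathcal{E}$ is a Kähler manifold with holomorphic coordinates $z_k=\theta_k+i\dot\theta_k$ and metric given by the block-diagonal matrix $\mathrm{diag}(h_F(\theta),h_F(\theta))$. A parallel lattice $L\subset T\mathcal{E}$ is the set of all integer combinations $\sum k_iY_i(p)$, $p\in\mathcal{E}$, of a frame $Y=(Y_1,\dots,Y_n)$ of $\nabla^{(e)}$-parallel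 vector fields on $\mathcal{E}$ (a generator of $L$). $\Gamma(L)\cong\mathbb{Z}^n$ is the group of maps $u\mapsto u+\sum k_iY_i$ of $T\mathcal{E}$; $\mathcal{E}_L=T\mathcal{E}/\Gamma(L)$ with its induced Kähler structure, $q_L:T\mathcal{E}\to\mathcal{E}_L$ is the quotient map, $\pi_L:\mathcal{E}_L\to\mathcal{E}$ the induced projection, and $\mathbb{T}^n$ acts on $\mathcal{E}_L$ by $\Phi_Y([t],q_L(u))=q_L(u+\sum t_iY_i)$. $(N,\Phi)$ is a torification of $\mathcal{E}$ if there are a parallel lattice $L$, a generator $Y$ and a holomorphic isometric diffeomorphism $G:\mathcal{E}_L\to N^\circ$ with $G\circ(\Phi_Y)_a=\Phi_a\circ G$ for all $a\in\mathbb{T}^n$. It is regular if $N$ is connected, simply connected, complete and has real-analytic Kähler metric. A compatible projection is a map $\kappa=\pi_L\circ G^{-1}:N^\circ\to\mathcal{E}$ for some such triple $(L,Y,G)$. Natural extension. $\mathcal{P}_m$ is the set of all probability functions on $\Omega$, with the topology of pointwise convergence, and $\overline{\mathcal{E}}$ is the closure of $\mathcal{E}$ in $\mathcal{P}_m$. Each compatible projection $\kappa$ has a unique continuous extension $K:N\to\overline{\mathcal{E}}$, called its natural extension. Kähler functions and spectrum. A smooth $f:N\to\mathbb{R}$ is Kähler if its Hamiltonian vector field $X_f$ (defined by $\omega(X_f,\cdot)=df$) is Killing. $\mathrm{Aut}(N,g)^0$ is the identity component of the group of holomorphic isometries of $N$ (compact-open topology). Every Kähler function can be written as $f(p)=\mathbb{E}_{K(\phi(p))}(X)$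 for all $p\in N$, with $X\in\mathcal{A}_{\mathcal{E}}$, $\phi\in\mathrm{Aut}(N,g)^0$ and $K$ the natural extension of a compatible projection; when $F$ is injective, the image of $X$ does not depend on the choice of $K,\phi,X$, and $\mathrm{spec}(f):=\{X(x_1),\dots,X(x_m)\}$. *)

(* Defs.v *)
From HB Require Import structures.
From mathcomp Require Import all_boot all_order all_algebra generic_quotient.
From mathcomp Require Import all_classical all_reals all_analysis.

Set Implicit Arguments.
Unset Strict Implicit.
Unset Printing Implicit Defensive.

Import Order.TTheory GRing.Theory Num.Theory numFieldNormedType.Exports.
Local Open Scope classical_set_scope.
Local Open Scope ring_scope.
Local Open Scope quotient_scope.

Section Calculus.
Variable R : realType.

(* In finite dimension this is the usual class C^k on an open set U. *)
Fixpoint Ck (V W : normedModType R) (k : nat) (U : set V) (f : V -> W) : Prop :=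
  if k is k'.+1 then
    (forall x, U x -> differentiable f x) /\
    (forall v, Ck k' U (fun x => 'D_v f x))
  else forall x, U x -> {for x, continuous f}.

Definition smooth_on (V W : normedModType R) (U : set V) (f : V -> W) : Prop :=
  forall k, Ck k U f.

Definition smooth_at (V W : normedModType R) (x : V) (f : V -> W) : Prop :=
  exists2 U, open_nbhs x U & smooth_on U f.

(* The multi-indices of degree k are the m : {ffun 'I_d -> 'I_k.+1} with
   \sum_i m i = k. *)
Definition analytic_at (d : nat) (f : 'rV[R]_d -> R) (x : 'rV[R]_d) : Prop :=
  exists (r : R) (a : ('I_d -> nat) -> R),
    [/\ 0 < r,
        cvgn (series (fun k : nat =>
          (\sum_(m : {ffun 'I_d -> 'I_k.+1} | (\sum_i m i)%N == k)
             `|a (fun i => m i)|) * r ^+ k))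
      & forall h : 'rV[R]_d, `|h| < r ->
          series (fun k : nat =>
            \sum_(m : {ffun 'I_d -> 'I_k.+1} | (\sum_i m i)%N == k)
               a (fun i => m i) * \prod_i h 0 i ^+ m i) @ \oo --> f (x + h)].

End Calculus.

Section Manifolds.
Variable R : realType.

(* [param i] is only meaningful on the image of [coord i], where it is the
   inverse chart; the axioms are in [is_manifold]. *)
Record atlas (V : normedModType R) (M : topologicalType) := Atlas {
  chart : Type;
  dom : chart -> set M;
  coord : chart -> M -> V;
  param : chart -> V -> M }.

Definition coord_range (V : normedModType R) (M : topologicalType)
  (A : atlas V M) (i : chart A) : set V := coord i @` dom i.

Definition vector_atlas (V : normedModType R) : atlas V V :=
  @Atlas V V unit (fun=> setT) (fun=> id) (fun=> id).

Definition product_atlas (V W : normedModType R) (M M' : topologicalType)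
    (A : atlas V M) (B : atlas W M') : atlas (V * W)%type (M * M')%type :=
  @Atlas (V * W)%type (M * M')%type (chart A * chart B)%type
    (fun ij => dom ij.1 `*` dom ij.2)
    (fun ij p => (coord ij.1 p.1, coord ij.2 p.2))
    (fun ij x => (param ij.1 x.1, param ij.2 x.2)).

Definition is_manifold (V : normedModType R) (M : topologicalType)
    (A : atlas V M) : Prop :=
  [/\ hausdorff_space M, @second_countable M,
      forall p, exists i : chart A, dom i p,
      forall i : chart A,
        [/\ open (dom i), open (coord_range i),
            forall p, dom i p -> param i (coord i p) = p,
            forall p, dom i p -> {for p, continuous (coord i)}
          & forall x, coord_range i x -> {for x, continuous (param i)}]
    & forall i j : chart A,
        smooth_on (coord i @` (dom i `&` dom j)) (coord j \o param i)].

Definition smooth_map (V W : normedModType R) (M M' : topologicalType)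
    (A : atlas V M) (B : atlas W M') (D : set M) (F : M -> M') : Prop :=
  forall p, D p -> {for p, continuous F} /\
    forall (i : chart A) (j : chart B), dom i p -> dom j (F p) ->
      smooth_at (coord i p) (coord j \o F \o param i).

(* The differential of F at p, read in the charts i (source) and j (target). *)
Definition tangent_map (V W : normedModType R) (M M' : topologicalType)
    (A : atlas V M) (B : atlas W M') (F : M -> M')
    (i : chart A) (j : chart B) (p : M) : V -> W :=
  'd (coord j \o F \o param i) (coord i p).

Definition simply_connected (M : topologicalType) : Prop :=
  (forall p q : M, exists2 gam : R -> M,
      {within `[0, 1], continuous gam} & gam 0 = p /\ gam 1 = q) /\
  (forall gam : R -> M, {within `[0, 1], continuous gam} -> gam 0 = gam 1 ->
    exists2 H : R * R -> M,
      {within `[0, 1] `*` `[0, 1], continuous H} &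
      (forall t, t \in `[0, 1] -> H (t, 0) = gam t /\ H (t, 1) = gam 0) /\
      (forall s, s \in `[0, 1] -> H (0, s) = gam 0 /\ H (1, s) = gam 0)).

End Manifolds.

Section Kahler.
Variables (R : realType) (n : nat).

(* C^n is R^(n + n) through x + i y |-> (x, y); multiplication by the
   imaginary unit is (x, y) |-> (- y, x). *)
Definition cplx (v : 'rV[R]_(n + n)) : 'rV[R]_(n + n) :=
  v *m block_mx 0 1%:M (- 1%:M) 0.

Definition inner (d : nat) (A : 'M[R]_d) (u v : 'rV[R]_d) : R :=
  (u *m A *m v^T) 0 0.

(* Raw data: an atlas and the Gram matrices of the metric in each chart. *)
Record kahlerData := KahlerData {
  kspace :> topologicalType;
  katlas : atlas 'rV[R]_(n + n) kspace;
  kmetric : chart katlas -> 'rV[R]_(n + n) -> 'M[R]_(n + n) }.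

Definition kform (M : kahlerData) (i : chart (katlas M)) (x u v : 'rV[R]_(n + n))
  : R := inner (kmetric i x) (cplx u) v.

Definition is_complex_manifold (M : kahlerData) : Prop :=
  is_manifold (katlas M) /\
  forall (i j : chart (katlas M)) (p : M), dom i p -> dom j p -> forall v,
    tangent_map (A := katlas M) (B := katlas M) id i j p (cplx v) =
    cplx (tangent_map (A := katlas M) (B := katlas M) id i j p v).

Definition is_riemannian (M : kahlerData) : Prop :=
  (forall i : chart (katlas M),
    smooth_on (coord_range i) (kmetric i) /\
    forall x, coord_range i x ->
      (kmetric i x)^T = kmetric i x /\
      forall v, v != 0 -> 0 < inner (kmetric i x) v v) /\
  (forall (i j : chart (katlas M)) (p : M), dom i p -> dom j p -> forall u v,
    let T := tangent_map (A := katlas M) (B := katlas M) id i j p in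
    inner (kmetric j (coord j p)) (T u) (T v) =
    inner (kmetric i (coord i p)) u v).

Definition is_kahler (M : kahlerData) : Prop :=
  [/\ is_complex_manifold M, is_riemannian M
    & forall (i : chart (katlas M)) (x : 'rV[R]_(n + n)), coord_range i x ->
        (forall u v, inner (kmetric i x) (cplx u) (cplx v) =
                     inner (kmetric i x) u v) /\
        (forall u v w, 'D_u (fun y => kform i y v w) x +
                       'D_v (fun y => kform i y w u) x +
                       'D_w (fun y => kform i y u v) x = 0)].

Definition holomorphic_map (M M' : kahlerData) (D : set M) (F : M -> M') : Prop :=
  smooth_map (katlas M) (katlas M') D F /\
  forall (i : chart (katlas M)) (j : chart (katlas M')) (p : M),
    D p -> dom i p -> dom j (F p) -> forall v,
    tangent_map F i j p (cplx v) = cplx (tangent_map F i j p v).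

Definition isometric_map (M M' : kahlerData) (D : set M) (F : M -> M') : Prop :=
  forall (i : chart (katlas M)) (j : chart (katlas M')) (p : M),
    D p -> dom i p -> dom j (F p) -> forall u v,
    inner (kmetric j (coord j (F p))) (tangent_map F i j p u)
                                      (tangent_map F i j p v) =
    inner (kmetric i (coord i p)) u v.

Definition holomorphic_isometry (M : kahlerData) (F : M -> M) : Prop :=
  [/\ holomorphic_map setT F, isometric_map setT F
    & exists2 H : M -> M, cancel F H /\ cancel H F & holomorphic_map setT H].

Definition Aut0 (M : kahlerData) : set {compact-open, M -> M} :=
  connected_component
    ([set F | holomorphic_isometry F] : set {compact-open, M -> M}) id.

Definition smooth_function (M : kahlerData) (f : M -> R) : Prop :=
  smooth_map (katlas M) (vector_atlas R) setT f.

(* A vector field is given by its components in each chart.  The Killing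
   equation L_X g = 0 is evaluated on constant vector fields u, v, for which
   [X, u] = - D_u X. *)
Definition hamiltonian_field (M : kahlerData) (f : M -> R)
    (X : chart (katlas M) -> 'rV[R]_(n + n) -> 'rV[R]_(n + n)) : Prop :=
  forall (i : chart (katlas M)) x, coord_range i x ->
    forall v, kform i x (X i x) v = 'd (f \o param i) x v.

Definition killing_field (M : kahlerData)
    (X : chart (katlas M) -> 'rV[R]_(n + n) -> 'rV[R]_(n + n)) : Prop :=
  forall (i : chart (katlas M)) x, coord_range i x -> forall u v,
    'D_(X i x) (fun y => inner (kmetric i y) u v) x +
    inner (kmetric i x) ('D_u (X i) x) v +
    inner (kmetric i x) u ('D_v (X i) x) = 0.

Definition kahler_function (M : kahlerData) (f : M -> R) : Prop :=
  smooth_function f /\ exists2 X, hamiltonian_field f X & killing_field X.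

Definition critical_point (M : kahlerData) (f : M -> R) (p : M) : Prop :=
  forall i : chart (katlas M), dom i p ->
    forall v, 'd (f \o param i) (coord i p) v = 0.

Definition critical_values (M : kahlerData) (f : M -> R) : set R :=
  [set l | exists2 p, f p = l & critical_point f p].

(* Smooth curves suffice: a piecewise smooth curve can be reparametrized so as
   to stop at its corners and endpoints, without changing its length. *)
Definition riemannian_distance (M : kahlerData) (p q : M) : \bar R :=
  ereal_inf [set l | exists (gam : R -> M) (speed : R -> R),
    [/\ smooth_map (vector_atlas R) (katlas M) setT gam,
        gam 0 = p /\ gam 1 = q,
        forall (t : R) (i : chart (katlas M)), dom i (gam t) ->
          let v := derive1 (coord i \o gam) t in
          speed t = Num.sqrt (inner (kmetric i (coord i (gam t))) v v)
      & l = (\int[lebesgue_measure]_(t in `[0%R, 1%R]) (speed t)%:E)%E]].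

Definition complete_metric (M : kahlerData) : Prop :=
  forall u : nat -> M,
    (forall e : R, 0 < e -> exists k0 : nat, forall k l : nat,
       (k0 <= k)%N -> (k0 <= l)%N -> (riemannian_distance (u k) (u l) < e%:E)%E) ->
    exists p : M, u @ \oo --> p.

Definition analytic_metric (M : kahlerData) : Prop :=
  forall (i : chart (katlas M)) x, coord_range i x ->
    forall a b, analytic_at (fun y => kmetric i y a b) x.

Definition regular (M : kahlerData) : Prop :=
  [/\ connected [set: M], simply_connected R M, complete_metric M
    & analytic_metric M].

End Kahler.

Section Toric.
Variables (R : realType) (n : nat).

Definition integral_vector (a : 'rV[R]_n) : Prop :=
  forall i, a 0 i \is a Num.int.

(* An action of R^n / Z^n is an action of R^n that is trivial on Z^n; it is
   smooth on the torus iff it is smooth on R^n, the quotient map being a local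
   diffeomorphism. *)
Definition torus_action (M : kahlerData R n) (Phi : 'rV[R]_n -> M -> M) : Prop :=
  [/\ forall p, Phi 0 p = p,
      forall a b p, Phi (a + b) p = Phi a (Phi b p),
      forall a p, integral_vector a -> Phi a p = p
    & smooth_map (product_atlas (vector_atlas 'rV[R]_n) (katlas M)) (katlas M)
        setT (fun ap => Phi ap.1 ap.2)].

Definition effective (M : kahlerData R n) (Phi : 'rV[R]_n -> M -> M) : Prop :=
  forall a, (forall p, Phi a p = p) -> integral_vector a.

Definition free_locus (M : kahlerData R n) (Phi : 'rV[R]_n -> M -> M) : set M :=
  [set p | forall a, Phi a p = p -> integral_vector a].

Definition dotprod (u v : 'rV[R]_n) : R := \sum_k u 0 k * v 0 k.

Definition momentum_map (M : kahlerData R n) (Phi : 'rV[R]_n -> M -> M)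
    (J : M -> 'rV[R]_n) : Prop :=
  [/\ smooth_map (katlas M) (vector_atlas 'rV[R]_n) setT J,
      forall a p, J (Phi a p) = J p
    & forall (xi : 'rV[R]_n) (i : chart (katlas M)) (p : M), dom i p -> forall v,
        kform i (coord i p)
          (derive1 (fun t : R => coord i (Phi (t *: xi) p)) 0) v =
        'd (fun x => dotprod (J (param i x)) xi) (coord i p) v].

Definition is_kahler_toric (M : kahlerData R n) (Phi : 'rV[R]_n -> M -> M)
    (J : M -> 'rV[R]_n) : Prop :=
  [/\ connected [set: M] /\ compact [set: M], is_kahler M,
      torus_action Phi /\ effective Phi,
      forall a, holomorphic_isometry (Phi a)
    & momentum_map Phi J].

End Toric.

Section ExponentialFamily.
Variables (R : realType) (n : nat) (Omega : finType).

Definition exp_density (C : Omega -> R) (F : 'I_n -> Omega -> R)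
    (psi : 'rV[R]_n -> R) (theta : 'rV[R]_n) (x : Omega) : R :=
  expR (C x + \sum_k theta 0 k * F k x - psi theta).

Record expFamily := ExpFamily {
  efC : Omega -> R;
  efF : 'I_n -> Omega -> R;
  efpsi : 'rV[R]_n -> R;
  efP : forall theta, \sum_x exp_density efC efF efpsi theta x = 1;
  ef_free : forall (c0 : R) (c : 'I_n -> R),
    (forall x, c0 + \sum_k c k * efF k x = 0) ->
    c0 = 0 /\ forall k, c k = 0 }.

Variable E : expFamily.

Definition density (theta : 'rV[R]_n) : {ptws Omega -> R} :=
  exp_density (efC E) (efF E) (efpsi E) theta.

Definition expect (p : {ptws Omega -> R}) (X : Omega -> R) : R :=
  \sum_x X x * p x.

Definition estimator (x : Omega) : 'rV[R]_n := \row_k efF E k x.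

Definition affine_span : set (Omega -> R) :=
  [set X | exists (c0 : R) (c : 'I_n -> R),
     forall x, X x = c0 + \sum_k c k * efF E k x].

Definition prob_functions : set {ptws Omega -> R} :=
  [set p | (forall x, 0 <= p x) /\ \sum_x p x = 1].

Definition ef_closure : set {ptws Omega -> R} :=
  closure (range density) `&` prob_functions.

Definition fisher (theta : 'rV[R]_n) : 'M[R]_n :=
  \matrix_(i, j) expect (density theta) (fun x =>
    'D_(delta_mx 0 i) (fun t => ln (density t x)) theta *
    'D_(delta_mx 0 j) (fun t => ln (density t x)) theta).

(* A frame of vector fields on the family, in the chart theta: Y_i at theta is
   row i of Y theta.  The coordinates theta being affine for the exponential
   connection, its covariant derivative is the componentwise derivative. *)
Definition parallel_frame (Y : 'rV[R]_n -> 'M[R]_n) : Prop :=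
  forall theta, [/\ Y theta \in unitmx, differentiable Y theta
                  & forall v, 'D_v Y theta = 0].

(* Points of the tangent bundle are written (theta, thetadot) in R^(n + n). *)
Definition tshift (Y : 'rV[R]_n -> 'M[R]_n) (t : 'rV[R]_n)
    (u : 'rV[R]_(n + n)) : 'rV[R]_(n + n) :=
  u + row_mx 0 (t *m Y (lsubmx u)).

Section Quotient.
Variable Y : 'rV[R]_n -> 'M[R]_n.

Definition lattice_rel (u u' : 'rV[R]_(n + n)) : bool :=
  `[< exists2 k : 'rV[R]_n, integral_vector k & u' = tshift Y k u >].

Lemma tshift_base t u : lsubmx (tshift Y t u) = lsubmx u.
Proof. by rewrite /tshift linearD /= row_mxKl addr0. Qed.

Lemma tshiftD s t u : tshift Y s (tshift Y t u) = tshift Y (t + s) u.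
Proof.
by rewrite /(tshift Y s _) tshift_base /tshift -addrA add_row_mx addr0 mulmxDl.
Qed.

Lemma tshift0 u : tshift Y 0 u = u.
Proof. by rewrite /tshift mul0mx row_mx0 addr0. Qed.

Lemma lattice_rel_equiv : equiv_class_of lattice_rel.
Proof.
split=> [u | u u' | u' u u''].
- apply/asboolP; exists 0; last by rewrite tshift0.
  by move=> i; rewrite mxE rpred0.
- have lsym v v' : lattice_rel v v' -> lattice_rel v' v.
    move=> /asboolP [k ik ->]; apply/asboolP; exists (- k).
      by move=> i; rewrite mxE rpredN.
    by rewrite tshiftD addrN tshift0.
  by apply/idP/idP; apply: lsym.
- move=> /asboolP [k ik ->] /asboolP [l il ->]; apply/asboolP; exists (k + l).
    by move=> i; rewrite mxE rpredD.
  by rewrite tshiftD.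
Qed.

Canonical lattice_equiv := EquivRelPack lattice_rel_equiv.

Definition EL : topologicalType := quotient_topology {eq_quot lattice_equiv}.

Definition qL (u : 'rV[R]_(n + n)) : EL := \pi_({eq_quot lattice_equiv}) u.

Definition piL (e : EL) : 'rV[R]_n :=
  lsubmx (repr (e : {eq_quot lattice_equiv})).

(* The charts of the quotient are the inverses of the restrictions of qL to the
   open sets on which it is injective. *)
Definition EL_atlas : atlas 'rV[R]_(n + n) EL :=
  @Atlas R 'rV[R]_(n + n) EL {U | open U /\ set_inj U qL}
    (fun U => qL @` sval U)
    (fun U e => xget 0 [set u | sval U u /\ qL u = e])
    (fun=> qL).

Definition EL_kahler : kahlerData R n :=
  @KahlerData R n EL EL_atlas (fun _ u =>
    block_mx (fisher (lsubmx u)) 0 0 (fisher (lsubmx u))).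

End Quotient.

Section Torification.
Variables (N : kahlerData R n) (Phi : 'rV[R]_n -> N -> N).

Definition torification_data (Y : 'rV[R]_n -> 'M[R]_n) (G : EL_kahler Y -> N)
  : Prop :=
  [/\ parallel_frame Y,
      holomorphic_map setT G /\ isometric_map setT G,
      range G = free_locus Phi,
      exists2 H : N -> EL_kahler Y, cancel G H &
        smooth_map (katlas N) (katlas (EL_kahler Y)) (free_locus Phi) H
    & forall t u, G (qL Y (tshift Y t u)) = Phi t (G (qL Y u))].

Definition torification : Prop :=
  exists (Y : 'rV[R]_n -> 'M[R]_n) (G : EL_kahler Y -> N), torification_data G.

(* The values of kappa outside the free locus are irrelevant. *)
Definition compatible_projection (kappa : N -> {ptws Omega -> R}) : Prop :=
  exists (Y : 'rV[R]_n -> 'M[R]_n) (G : EL_kahler Y -> N),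
    torification_data G /\ forall e, kappa (G e) = density (piL e).

Definition natural_extension (K : N -> {ptws Omega -> R}) : Prop :=
  exists2 kappa, compatible_projection kappa &
    [/\ continuous K, forall p, ef_closure (K p)
      & forall p, free_locus Phi p -> K p = kappa p].

(* S is spec(f); the spectrum is a relation because it is defined through a
   choice of (K, phi, X), on which it does not depend if F is injective. *)
Definition is_spectrum (f : N -> R) (S : set R) : Prop :=
  exists (K : N -> {ptws Omega -> R}) (phi : N -> N) (X : Omega -> R),
    [/\ natural_extension K, @Aut0 R n N phi, affine_span X,
        forall p, f p = expect (K (phi p)) X
      & S = range X].

End Torification.
End ExponentialFamily.

(* Main.v *)
(* Write f = f0 o phi with f0(q) = E_{K(q)}(X) and X = c0 + sum_k c_k F_k.  At a
   point q of the free locus, the gradient of f0 is the image v of the constant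
   real vector c of the tangent bundle, and both df0(v) and g(v, v) are equal to
   the variance of X under K(q).  Near a critical point of f0 the squared norm
   g(v, v) of the gradient is small; the free locus being dense, the variance of
   X under K(q) vanishes at a critical point q, so that X is constant on the
   support of K(q), and f0(q) is the value of X there.

   Density of the free locus: a nontrivial stabilizer, being a closed subgroup
   of R^n that strictly contains Z^n, contains a non-integral vector a that is
   torsion in R^n / Z^n.  The action of a is a diffeomorphism of finite order,
   the interior of whose fixed locus is closed, hence empty by connectedness and
   effectiveness.  Baire's theorem applied to the countably many torsion vectors
   concludes. *)
From HB Require Import structures.
From mathcomp Require Import all_boot all_order all_algebra generic_quotient.
From mathcomp Require Import all_classical all_reals all_analysis.
From mathcomp Require Import ring lra zify.
Require Import Defs.

Set Implicit Arguments.
Unset Strict Implicit.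
Unset Printing Implicit Defensive.

Import Order.TTheory GRing.Theory Num.Theory numFieldNormedType.Exports.
Local Open Scope classical_set_scope.
Local Open Scope ring_scope.

Section Topology.
Variables S T : topologicalType.

Lemma closure_equalizer (f g : S -> T) x : hausdorff_space T ->
  {for x, continuous f} -> {for x, continuous g} ->
  closure [set y | f y = g y] x -> f x = g x.
Proof.
move=> hT cf cg clx; apply: hT => A B fA gB.
have fgAB : nbhs x (f @^-1` A `&` g @^-1` B).
  by apply: filterI; [exact: cf|exact: cg].
have [y [/= fg [Ay By]]] := clx _ fgAB.
by exists (f y); split => //; rewrite fg.
Qed.

Lemma closed_equalizer (f g : S -> T) : hausdorff_space T ->
  continuous f -> continuous g -> closed [set x | f x = g x].
Proof. by move=> hT cf cg x; exact: closure_equalizer hT (cf x) (cg x). Qed.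

Lemma cvg_iter_fixed (f : S -> S) (x : S) k :
  {for x, continuous f} -> f x = x -> iter k f y @[y --> x] --> x.
Proof.
move=> cf fx; elim: k => [|k IH]; first exact: cvg_id.
by rewrite -[X in _ --> X]fx; exact: cvg_comp IH cf.
Qed.

Lemma dense_nbhs (D : set S) (x : S) (B : set S) :
  dense D -> nbhs x B -> exists2 y, D y & B y.
Proof.
move=> dD; rewrite nbhsE => -[U [oU Ux] UB].
by have [y [Uy Dy]] := dD U (ex_intro _ x Ux) oU; exists y => //; exact: UB.
Qed.

Lemma dense_setC (A : set S) : A° = set0 -> dense (~` A).
Proof.
move=> A0 U [x Ux] oU; apply/set0P/negP => /eqP UA0.
suff : A° x by rewrite A0.
apply: filterS (open_nbhs_nbhs (conj oU Ux)).
by apply/subsets_disjoint.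
Qed.

End Topology.

(** * Maps of class C^1 *)

Section MatrixNorm.
Variable R : realType.

Lemma mx_entry_le_norm m n (M : 'M[R]_(m, n)) i j : `|M i j| <= `|M|.
Proof.
rewrite [leRHS]/Num.Def.normr/= mx_normrE.
by apply/bigmax_geP; right; exists (i, j).
Qed.

Lemma mx_norm_le m n (M : 'M[R]_(m, n)) (e : R) :
  0 <= e -> (forall i j, `|M i j| <= e) -> `|M| <= e.
Proof.
move=> e0 Me; rewrite [leLHS]/Num.Def.normr/= mx_normrE.
by apply: bigmax_le => // -[i j] _; exact: Me.
Qed.

End MatrixNorm.

HB.instance Definition _ (R : realType) m n :=
  Uniform_isComplete.Build 'M[R]_(m, n) (@mx_complete R m n).

Section Calculus.
Variable R : realType.
Implicit Types U V W : normedModType R.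

Lemma cvg_fsum T (F : set_system T) (FF : Filter F) W (I : finType)
    (f : I -> T -> W) (l : I -> W) :
  (forall i, f i x @[x --> F] --> l i) ->
  \sum_i f i x @[x --> F] --> \sum_i l i.
Proof. by move=> fl; apply: cvg_big => //; exact: add_continuous. Qed.

Lemma linear_rV_continuous d W (f : 'rV[R]_d -> W) : linear f -> continuous f.
Proof.
move=> lf; pose g : {linear 'rV[R]_d -> W} :=
  HB.pack f (GRing.isLinear.Build _ _ _ _ _ lf).
have fE : f = fun x => \sum_k x 0 k *: f (delta_mx 0 k).
  apply/funext => x; rewrite -[f]/(g : _ -> _) {1}(row_sum_delta x) linear_sum.
  by apply: eq_bigr => k _; rewrite linearZ.
rewrite fE => x; apply: (@cvg_fsum _ (nbhs x)) => k.
by apply: cvgZr_tmp; exact: coord_continuous.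
Qed.

Lemma linear_rV_is_diff d W (f : 'rV[R]_d -> W) x : linear f -> is_diff x f f.
Proof.
move=> lf; pose g : {linear 'rV[R]_d -> W} :=
  HB.pack f (GRing.isLinear.Build _ _ _ _ _ lf).
have cg : continuous g by exact: linear_rV_continuous.
exact: DiffDef (@linear_differentiable _ _ _ g x cg) (diff_lin x cg).
Qed.

Lemma linear_rV_differentiable d W (f : 'rV[R]_d -> W) x :
  linear f -> differentiable f x.
Proof. by move=> /(linear_rV_is_diff x)[]. Qed.

Lemma derive_linear_rV d W (f : 'rV[R]_d -> W) x v : linear f -> 'D_v f x = f v.
Proof. by move=> /(linear_rV_is_diff x)[df dfE]; rewrite deriveE// dfE. Qed.

Lemma derive_coordE W d (f : 'rV[R]_d -> W) x v : differentiable f x ->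
  'D_v f x = \sum_k v 0 k *: 'D_(delta_mx 0 k) f x.
Proof.
move=> df; rewrite deriveE// [in LHS](row_sum_delta v) linear_sum.
by apply: eq_bigr => k _; rewrite linearZ deriveE.
Qed.

Lemma derive_comp U V W (g : U -> V) (f : V -> W) x v :
  differentiable g x -> differentiable f (g x) ->
  'D_v (f \o g) x = 'D_('D_v g x) f (g x).
Proof.
move=> dg df; rewrite deriveE; last exact: differentiable_comp.
by rewrite diff_comp//= (deriveE _ dg) deriveE.
Qed.

Lemma differentiable_fsum V W (I : finType) (f : I -> V -> W) x :
  (forall i, differentiable (f i) x) ->
  differentiable (fun y => \sum_i f i y) x.
Proof.
move=> df; rewrite -fct_sumE.
by elim/big_ind : _ => // g h dg dh; exact: differentiableD.
Qed.

Lemma derive_fsum V W (I : finType) (f : I -> V -> W) x v :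
  (forall i, differentiable (f i) x) ->
  'D_v (fun y => \sum_i f i y) x = \sum_i 'D_v (f i) x.
Proof.
move=> df; rewrite -fct_sumE [in LHS]big_enum_val [RHS]big_enum_val.
by rewrite derive_sum// => i; exact: diff_derivable.
Qed.

Lemma differentiable_expR (y : R) : differentiable expR y.
Proof. by apply/derivable1_diffP; exact: derivable_expR. Qed.

Lemma near_eq_differentiable V W (f g : V -> W) x :
  (\forall y \near x, f y = g y) -> differentiable f x -> differentiable g x.
Proof.
move=> fg dfx; have [cdf dfE] := (diff_locallyP x f).1 dfx.
have dgE : g \o shift x = cst (g x) + 'd f x +o_ 0 id.
  move/eqaddoP : dfE => dfE; apply/eqaddoP => e e0.
  have fg0 : \forall h \near (0 : V), f (h + x) = g (h + x).
    by move: fg; rewrite (near_shift 0 x)/= subr0.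
  near=> h; rewrite !fctE -(near fg0 h)// -(nbhs_singleton fg).
  by near: h; exact: dfE.
by apply/diff_locallyP; rewrite (diff_unique cdf dgE).
Unshelve. all: by end_near. Qed.

Lemma ball_segment V (x y z : V) (r t : R) : t \in `[0, 1]%R ->
  ball x r y -> ball x r z -> ball x r (z + t *: (y - z)).
Proof.
rewrite in_itv/= -!ball_normE/= => /andP[t0 t1] xy xz.
have t1' : 0 <= 1 - t by rewrite subr_ge0.
have -> : x - (z + t *: (y - z)) = t *: (x - y) + (1 - t) *: (x - z).
  rewrite scalerBl scale1r addrCA -scalerBr opprB [x - y + _]addrC subrKA.
  by rewrite opprD addrA -scalerN opprB.
apply: le_lt_trans (ler_normD _ _) _.
rewrite !normrZ (ger0_norm t0) (ger0_norm t1').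
by have [] := leP `|x - y| `|x - z|; nra.
Qed.

Lemma mean_value_le V m n (f : V -> 'M[R]_(m, n)) x y (C : R) :
  (forall t : R, t \in `[0, 1]%R -> differentiable f (y + t *: (x - y)) /\
    `|'D_(x - y) f (y + t *: (x - y))| <= C) ->
  `|f x - f y| <= C.
Proof.
pose v := x - y; pose seg (t : R) := y + t *: v => fC.
have C0 : 0 <= C.
  have [|_] := fC 0; first by rewrite in_itv/= lexx ler01.
  exact: le_trans.
apply: mx_norm_le => // i j; rewrite 2!mxE.
pose h (t : R) : R := f (seg t) i j.
have hder (t : R) : t \in `[0, 1]%R -> is_derive t 1 h ('D_v f (seg t) i j).
  move=> /fC[df _].
  have dseg : differentiable seg t by [].
  have dfseg : differentiable (f \o seg) t by exact: differentiable_comp.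
  have dh : differentiable h t.
    apply: (@differentiable_comp _ _ _ _ (f \o seg) (fun M => M i j)) => //.
    exact: differentiable_coord.
  split; first exact: diff_derivable.
  have <- : 'D_1 (f \o seg) t = 'D_v f (seg t).
    rewrite derive_comp// (_ : 'D_1 seg t = v)//.
    by rewrite deriveE// diff_val/= add0r scale1r.
  by rewrite derive_mx ?mxE//; exact: diff_derivable.
have [|t t01] := @MVT_segment _ h (fun t => 'D_v f (seg t) i j) 0 1 ler01
  (fun t t01 => hder t (subset_itv_oo_cc t01)).
  by apply: derivable_within_continuous => t /hder[].
rewrite /h /seg scale0r addr0 scale1r subrKC subr0 mulr1 => ->.
exact: le_trans (mx_entry_le_norm _ _ _) (fC t t01).2.
Qed.

End Calculus.

Section ContinuouslyDifferentiable.
Variable R : realType.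
Implicit Types U V W : normedModType R.

Definition C1_at V W (x : V) (f : V -> W) : Prop :=
  (\forall y \near x, differentiable f y) /\
  forall v, {for x, continuous ('D_v f)}.

Lemma smooth_at_C1 V W (x : V) (f : V -> W) : smooth_at x f -> C1_at x f.
Proof.
move=> [U [oU Ux] sf]; have [dU cU] := sf 1%N.
split=> [|v]; last exact: cU.
by apply: filterS (open_nbhs_nbhs (conj oU Ux)).
Qed.

Lemma C1_at_differentiable V W (x : V) (f : V -> W) :
  C1_at x f -> differentiable f x.
Proof. by move=> [/nbhs_singleton]. Qed.

Lemma C1_at_continuous V W (x : V) (f : V -> W) :
  C1_at x f -> {for x, continuous f}.
Proof. by move/C1_at_differentiable/differentiable_continuous. Qed.

Lemma near_eq_C1_at V W (x : V) (f g : V -> W) :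
  (\forall y \near x, f y = g y) -> C1_at x f -> C1_at x g.
Proof.
move=> /near_join fg [df cDf]; split.
  by near=> y; apply: (@near_eq_differentiable _ _ _ f); near: y.
move=> v; suff : 'D_v g y @[y --> x] --> 'D_v g x by [].
rewrite -(near_eq_derive v (nbhs_singleton fg)).
apply: cvg_trans (cDf v); apply: near_eq_cvg.
by apply: filterS fg => y; exact: near_eq_derive.
Unshelve. all: by end_near. Qed.

Lemma C1_at_comp U W d (g : U -> 'rV[R]_d) (f : 'rV[R]_d -> W) x :
  C1_at x g -> C1_at (g x) f -> C1_at x (f \o g).
Proof.
move=> C1g C1f; have cg := C1_at_continuous C1g.
have [dg cDg] := C1g; have [df cDf] := C1f.
have dfg : \forall y \near x, differentiable f (g y) by exact: cg df.
have chain : \forall y \near x, forall v,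
    \sum_k 'D_v g y 0 k *: 'D_(delta_mx 0 k) f (g y) = 'D_v (f \o g) y.
  near=> y; move=> v.
  have dgy : differentiable g y by near: y.
  have dfy : differentiable f (g y) by near: y.
  by rewrite (derive_comp v dgy dfy) (derive_coordE _ dfy).
split; first by near do apply: differentiable_comp.
move=> v; suff : 'D_v (f \o g) y @[y --> x] --> 'D_v (f \o g) x by [].
rewrite -(nbhs_singleton chain).
apply: cvg_trans (near_eq_cvg (filterS (fun y => @^~ v) chain)) _.
apply: (@cvg_fsum _ _ (nbhs x)) => k; apply: cvgZ.
  exact: cvg_comp (cDg v) (@coord_continuous _ _ _ _ _ _).
exact: cvg_comp cg (cDf _).
Unshelve. all: by end_near. Qed.

Lemma C1_at_derive_near d W (f : 'rV[R]_d -> W) x (e : R) :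
  C1_at x f -> 0 < e ->
  \forall y \near x, forall v, `|'D_v f y - 'D_v f x| <= e * `|v|.
Proof.
move=> C1f e0; have [df cDf] := C1f; pose e' := e / d.+1%:R.
have e'0 : 0 < e' by rewrite divr_gt0.
have Dk : \forall y \near x, forall k : 'I_d,
    `|'D_(delta_mx 0 k) f y - 'D_(delta_mx 0 k) f x| <= e'.
  near=> y; near: y; apply: filter_forall => k.
  have /cvgrPdist_le/(_ _ e'0) := cDf (delta_mx 0 k).
  by apply: filterS => y; rewrite distrC.
near=> y => v.
rewrite !derive_coordE; [|exact: C1_at_differentiable|by near: y].
rewrite -sumrB; apply: le_trans (ler_norm_sum _ _ _) _.
apply: (@le_trans _ _ (\sum_(k < d) e' * `|v|)).
  apply: ler_sum => k _; rewrite -scalerBr normrZ mulrC; apply: ler_pM => //.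
    by move: k; near: y.
  exact: mx_entry_le_norm.
rewrite sumr_const card_ord -mulrnAl ler_wpM2r// -mulr_natr -mulrA.
by rewrite ger_pMr// mulrC ler_pdivrMr// mul1r ler_nat.
Unshelve. all: by end_near. Qed.

Definition strict_diff_at V W (x : V) (f l : V -> W) : Prop :=
  forall e : R, 0 < e ->
    \forall y & z \near x, `|f y - f z - l (y - z)| <= e * `|y - z|.

Lemma C1_at_strict_diff d m n (f : 'rV[R]_d -> 'M[R]_(m, n)) x :
  C1_at x f -> strict_diff_at x f ('d f x).
Proof.
move=> C1f e e0; have dfx := C1_at_differentiable C1f.
have /nbhs_ballP[r /= r0 rP] : \forall y \near x, differentiable f y /\
    forall v, `|'D_v f y - 'D_v f x| <= e * `|v|.
  by apply: filterI (C1f.1) (C1_at_derive_near C1f e0).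
exists (ball x r, ball x r); first by split; exact: nbhsx_ballx.
move=> [y z] /= [xy xz].
pose l : 'rV[R]_d -> 'M[R]_(m, n) := 'd f x.
have lin_l : linear l by exact: linearP.
have -> : f y - f z - l (y - z) = (f - l) y - (f - l) z.
  rewrite /l linearB/= !fctE !opprB addrACA [RHS]addrACA.
  by congr (_ + _); exact: addrC.
apply: mean_value_le => t /ball_segment/(_ xy xz)/rP[dft Dft].
have dl := linear_rV_differentiable (z + t *: (y - z)) lin_l.
split; first exact: differentiableB.
rewrite deriveB; [|exact: diff_derivable..].
by rewrite (derive_linear_rV _ _ lin_l) /l -(deriveE _ dfx).
Qed.

Lemma strict_diff_id_iter V (g : V -> V) x k :
  g x = x -> {for x, continuous g} ->
  strict_diff_at x g id -> strict_diff_at x (iter k g) id.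
Proof.
move=> gx cg sg; elim: k => [|k IH] e e0.
  exists (setT, setT) => [|[y z] _ /=]; first by split; exact: filterT.
  by rewrite subrr normr0 mulr_ge0// ltW.
have cgk := cvg_iter_fixed k cg gx.
pose d := Num.min 1 (e / 3).
have d0 : 0 < d by rewrite lt_min ltr01 divr_gt0.
have d1 : d <= 1 by rewrite ge_min lexx.
have de : d <= e / 3 by rewrite ge_min lexx orbT.
have [[A B]/= [xA xB] AB] := sg d d0.
have [[A' B']/= [xA' xB'] AB'] := IH d d0.
exists (A' `&` iter k g @^-1` A, B' `&` iter k g @^-1` B).
  by split; apply: filterI => //; exact: cgk.
move=> [y z]/= [[A'y Ay] [B'z Bz]].
have := AB (_, _) (conj Ay Bz); have := AB' (y, z) (conj A'y B'z) => /=.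
set a := iter k g y; set b := iter k g z => ab gab.
have abyz : `|a - b| <= 2 * `|y - z|.
  rewrite -(subrK (y - z) (a - b)); apply: le_trans (ler_normD _ _) _.
  by have := normr_ge0 (y - z); nra.
rewrite -(subrKA (a - b)); apply: le_trans (ler_normD _ _) _.
by have := normr_ge0 (y - z); nra.
Qed.

(* The average of the iterates of g is locally injective, its strict derivative
   being the identity, and takes the same value at y and g y. *)
Lemma strict_diff_id_periodic V (g : V -> V) x m : (0 < m)%N ->
  g x = x -> {for x, continuous g} -> strict_diff_at x g id ->
  (\forall y \near x, iter m g y = y) -> \forall y \near x, g y = y.
Proof.
move=> m0 gx cg sg gm.
have half0 : 0 < 2^-1 :> R by rewrite invr_gt0.
have : \forall y \near x, forall k : 'I_m,
    `|iter k g y - iter k g (g y) - (y - g y)| <= 2^-1 * `|y - g y|.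
  apply: filter_forall => k.
  have [[A B]/= [xA xB] AB] := strict_diff_id_iter k gx cg sg half0.
  have gxB : \forall y \near x, B (g y) by apply: cg; rewrite gx.
  by apply: filterS2 xA gxB => y Ay Bgy; exact: AB (y, g y) (conj Ay Bgy).
apply: filterS2 gm => y ym yk; apply/esym/eqP; rewrite -subr_eq0 -normr_le0.
have : (y - g y) *+ m =
    - \sum_(k < m) (iter k g y - iter k g (g y) - (y - g y)).
  rewrite sumrB sumr_const card_ord opprB -[LHS]subr0; congr (_ - _).
  under eq_bigr do rewrite -iterSr -opprB.
  rewrite sumrN -(big_mkord xpredT (fun k => iter k.+1 g y - iter k g y)).
  by rewrite telescope_sumr//= ym subrr oppr0.
move=> /(congr1 Num.norm); rewrite normrN normrMn => le_sum.
have : `|y - g y| *+ m <= (2^-1 * `|y - g y|) *+ m.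
  rewrite le_sum -[in leRHS](card_ord m) -sumr_const.
  by apply: le_trans (ler_norm_sum _ _ _) _; apply: ler_sum => k _; exact: yk.
by rewrite ler_pMn2r//; lra.
Qed.

Lemma C1_periodic_fixed d (g : 'rV[R]_d -> 'rV[R]_d) x m : (0 < m)%N ->
  C1_at x g -> (\forall y \near x, iter m g y = y) ->
  closure [set y | g y = y]° x -> \forall y \near x, g y = y.
Proof.
move=> m0 C1g gm clx; have cg := C1_at_continuous C1g.
have hausdorff_rV : hausdorff_space 'rV[R]_d := @norm_hausdorff R _.
have gx : g x = x.
  apply: (closure_equalizer (g := id) hausdorff_rV cg) => //.
  by apply: closureS clx; exact: interior_subset.
have dg : 'd g x = id :> ('rV[R]_d -> 'rV[R]_d).
  apply/funext => v; rewrite -deriveE; last exact: C1_at_differentiable.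
  apply: (closure_equalizer (f := 'D_v g) (g := cst v) hausdorff_rV (C1g.2 v)).
    exact: cst_continuous.
  apply: closureS clx => y gy /=.
  by rewrite -[RHS](derive_id y v); exact: near_eq_derive.
apply: strict_diff_id_periodic m0 gx cg _ gm.
by rewrite -[X in strict_diff_at _ _ X]dg; exact: C1_at_strict_diff.
Qed.

End ContinuouslyDifferentiable.

(** * Closed subgroups of R^n containing Z^n *)

Section CompactSets.
Variable R : realType.

Lemma compact_seq_cluster (V : normedModType R) (K : set V) (u : nat -> V) :
  compact K -> (forall j, K (u j)) ->
  exists2 l, K l & forall (e : R) N, 0 < e ->
    exists2 j, (N <= j)%N & `|u j - l| < e.
Proof.
move=> cK Ku.
have [|l [Kl cl]] := cK (u @ \oo) _.
  by exists 0%N => // j _; exact: Ku.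
exists l => // e N e0.
have [| |x [[j /= Nj <-]]] := cl (u @` [set j | (N <= j)%N]) (ball l e).
- by exists N => // j /= Nj; exists j.
- exact: nbhsx_ballx.
by rewrite -ball_normE/= distrC; exists j.
Qed.

Lemma compact_unit_sphere d : compact [set x : 'rV[R]_d | `|x| = 1].
Proof.
apply: bounded_closed_compact.
  by exists 1; split => // M M1 x /= ->; exact: ltW.
apply: closed_equalizer; first exact: (@norm_hausdorff R R^o).
- exact: norm_continuous.
- exact: cst_continuous.
Qed.

Lemma closed_submx m n (W : 'M[R]_(m, n)) :
  closed [set w : 'rV[R]_n | (w <= W)%MS].
Proof.
rewrite (_ : mkset _ = [set w : 'rV[R]_n | w *m cokermx W = 0]); last first.
  by apply/funext => w; apply/propext; rewrite /= submxE; split=> /eqP.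
apply: closed_equalizer; first exact: norm_hausdorff.
- by apply: linear_rV_continuous => c u v; rewrite mulmxDl scalemxAl.
- exact: cst_continuous.
Qed.

End CompactSets.

Definition additive_subgroup (V : zmodType) (H : set V) : Prop :=
  H 0 /\ forall a b, H a -> H b -> H (a - b).

Lemma additive_subgroupD (V : zmodType) (H : set V) a b :
  additive_subgroup H -> H a -> H b -> H (a + b).
Proof.
by move=> [H0 HB] Ha Hb; rewrite -[b]opprK -[- b]sub0r; apply/HB/HB.
Qed.

Lemma additive_subgroupMz (V : zmodType) (H : set V) a (z : int) :
  additive_subgroup H -> H a -> H (a *~ z).
Proof.
move=> sH Ha; have [H0 HB] := sH; have Hn k : H (a *+ k).
  by elim: k => [|k IH] //; rewrite mulrS; exact: additive_subgroupD.
case: z => k /=; first exact: Hn.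
by rewrite -[_ *~ _]sub0r; exact: HB.
Qed.

Lemma norm_sub_floor_scale (R : realType) (V : normedModType R) (w l : V)
    (s : R) : w != 0 ->
  `|s *: l - (Num.floor (s / `|w|))%:~R *: w| <=
  `|w| + `|s| * `| `|w|^-1 *: w - l|.
Proof.
rewrite -normr_gt0 => w0; set z := (Num.floor _)%:~R; set u := `|w|^-1 *: w.
have u1 : `|u| = 1 by rewrite normfZV -?normr_gt0.
have zwu : (z * `|w|) *: u = z *: w by rewrite scalerA mulfK ?gt_eqF.
move: u u1 zwu => u u1 zwu.
have -> : s *: l - z *: w = (s - z * `|w|) *: u - s *: (u - l).
  by rewrite scalerBr scalerBl zwu opprB [RHS]addrC subrKA.
apply: le_trans (ler_normB _ _) _; rewrite !normrZ u1 mulr1 lerD2r.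
have := floor_itv (s / `|w|); rewrite intrD -/z.
rewrite ler_pdivlMr// ltr_pdivrMr// mulrDl mul1r => /andP[zs sz].
by rewrite ger0_norm; lra.
Qed.

Section ClosedSubgroups.
Variables (R : realType) (n : nat).
Implicit Types (H : set 'rV[R]_n) (a v : 'rV[R]_n).

(* The multiples of a short w are |w|-dense in the line spanned by w, so the
   limit directions of ever shorter elements of H span lines contained in H. *)
Lemma closed_subgroup_line H m (W : 'M[R]_(m, n)) :
  closed H -> additive_subgroup H ->
  (forall e : R, 0 < e ->
    exists w, [/\ H w, (w <= W)%MS, w != 0 & `|w| < e]) ->
  exists u, [/\ (u <= W)%MS, u != 0 & forall s : R, H (s *: u)].
Proof.
move=> cH sH small.
have /choice[w wP] j :
    exists w, [/\ H w, (w <= W)%MS, w != 0 & `|w| < j.+1%:R^-1].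
  by apply: small; rewrite invr_gt0.
have Ku j : ([set x | `|x| = 1] `&` [set x : 'rV_n | (x <= W)%MS])
    (`|w j|^-1 *: w j).
  have [_ Ww w0 _] := wP j.
  by split; rewrite /= ?normfZV//; exact: scalemx_sub.
have cK := compact_closedI (@compact_unit_sphere R n) (@closed_submx R m n W).
have [l [/= l1 Wl] lP] := compact_seq_cluster cK Ku.
exists l; split => //; first by rewrite -normr_gt0 l1.
move=> s; apply: cH => B /nbhs_normP[e /= e0 eB].
have e20 : 0 < e / 2 by rewrite divr_gt0.
have s10 : 0 < `|s| + 1 by rewrite ltr_pwDr.
have [j Nj jl] :=
  lP (e / 2 / (`|s| + 1)) (Num.truncn (e / 2)^-1) (divr_gt0 e20 s10).
have [Hw _ w0 wj] := wP j.
have we : `|w j| < e / 2.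
  apply: lt_le_trans wj _; rewrite invf_ple ?posrE// ltW//.
  by apply: lt_le_trans (truncnS_gt _) _; rewrite ler_nat ltnS.
exists ((Num.floor (s / `|w j|))%:~R *: w j); split.
  by rewrite scaler_int; exact: additive_subgroupMz.
apply: eB; rewrite /ball_/=; apply: le_lt_trans (norm_sub_floor_scale _ _ w0) _.
rewrite [ltRHS]splitr ltr_leD//.
rewrite ltr_pdivlMr// mulrC in jl.
by apply: le_trans (ltW jl); rewrite ler_wpM2r// lerDl.
Qed.

Lemma maximal_contained_subspace (F : fieldType) (H : set 'rV[F]_n) :
  H 0 -> exists2 V : 'M[F]_n, (forall v : 'rV_n, (v <= V)%MS -> H v) &
    forall W : 'M[F]_n, (forall w : 'rV_n, (w <= W)%MS -> H w) ->
      (V <= W)%MS -> (W <= V)%MS.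
Proof.
move=> H0; pose contained (V : 'M[F]_n) := forall v : 'rV_n, (v <= V)%MS -> H v.
pose P k := `[< exists2 V, contained V & \rank V = k >].
have exP : exists k, P k.
  exists 0%N; apply/asboolP; exists 0; last exact: mxrank0.
  by move=> v; rewrite submx0 => /eqP ->.
have leP k : P k -> (k <= n)%N by move=> /asboolP[V _ <-]; exact: rank_leq_row.
case: (ex_maxnP exP leP) => _ /asboolP[V HV <-] rank_max.
exists V => // W HW VW; rewrite -(mxrank_leqif_sup VW).
by rewrite eqn_leq mxrankS// rank_max//; apply/asboolP; exists W.
Qed.

Lemma closed_subgroup_subspace H : closed H -> additive_subgroup H ->
  exists (V : 'M[R]_n) (e : R), [/\ 0 < e, forall v, (v <= V)%MS -> H v
    & forall h, H h -> `|h| < e -> (h <= V)%MS].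
Proof.
move=> cH sH; have [V HV Vmax] := maximal_contained_subspace sH.1.
exists V; apply: contrapT => noe.
pose Q := proj_mx (V^C)%MS V.
have dC : ((V^C) :&: V = 0)%MS by rewrite capmxC; exact: capmx_compl.
have sub_projV (h : 'rV[R]_n) : (h - h *m Q <= V)%MS.
  have <- : h *m proj_mx V (V^C)%MS = h - h *m Q.
    apply/(canRL (addrK _)); apply: add_proj_mx; first exact: capmx_compl.
    by apply: submx_full; exact: addsmx_compl_full.
  exact: proj_mx_sub.
have [e e0|u [Cu u0 Hu]] := @closed_subgroup_line H _ (V^C)%MS cH sH.
  have cQ : {for 0, continuous (mulmxr Q : 'rV[R]_n -> 'rV[R]_n)}.
    by apply: linear_rV_continuous; exact: linearP.
  have /cvgrPdist_lt/(_ _ e0)/nbhs_normP[d /= d0 dP] := cQ.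
  have [h [Hh hd hV]] : exists h, [/\ H h, `|h| < d & ~~ (h <= V)%MS].
    apply: contrapT => noh; apply: noe; exists d; split => // h Hh hd.
    by apply: contrapT => /negP hV; apply: noh; exists h.
  exists (h *m Q); split; last 1 first.
  + by have := dP h; rewrite /ball_/= mul0mx !sub0r !normrN; exact.
  + rewrite -[h *m Q](subKr h); apply: sH.2 => //; apply: HV; exact: sub_projV.
  + exact: proj_mx_sub.
  + by apply: contra hV => /eqP hQ; have := sub_projV h; rewrite hQ subr0.
have Vu : ((V + u)%MS <= V)%MS.
  apply: Vmax; last exact: addsmxSl.
  move=> v /sub_addsmxP[[a b]/= ->]; apply: additive_subgroupD => //.
    by apply: HV; exact: submxMl.
  by rewrite [b]mx11_scalar mul_scalar_mx.
move/negP : u0; apply; rewrite -submx0 -dC sub_capmx Cu.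
exact: submx_trans (addsmxSr _ _) Vu.
Qed.

Definition torsion_vector a : Prop :=
  exists2 k, (0 < k)%N & integral_vector (k%:R *: a).

Lemma integral_vector_map_mx a :
  integral_vector a -> exists z : 'rV[int]_n, a = map_mx intr z.
Proof.
move=> ia; exists (map_mx Num.floor a).
by apply/rowP => i; rewrite !mxE floorK.
Qed.

Lemma integral_vector_small a : integral_vector a -> `|a| < 1 -> a = 0.
Proof.
move=> ia a1; apply/rowP => i; rewrite mxE; have /intrP[z az] := ia i.
have := le_lt_trans (mx_entry_le_norm a 0 i) a1.
rewrite az -intr_norm -[1]/(1%:~R) ltr_int => z1.
by have -> : z = 0 by lia.
Qed.

Lemma countable_torsion_vector : countable torsion_vector.
Proof.
pose f (kz : nat * 'rV[int]_n) : 'rV[R]_n := kz.1%:R^-1 *: map_mx intr kz.2.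
have sub_range : torsion_vector `<=` range f.
  move=> a [k k0 /integral_vector_map_mx[z kaz]]; exists (k, z) => //.
  by rewrite /f/= -kaz scalerA mulVf ?scale1r// pnatr_eq0 -lt0n.
apply: sub_countable (subset_card_le sub_range) _.
by apply: sub_countable (card_image_le _ _) _; exact: countableP.
Qed.

Lemma integral_line_torsion a : integral_vector a -> a != 0 ->
  exists s : R, torsion_vector (s *: a) /\ ~ integral_vector (s *: a).
Proof.
move=> ia /rV0Pn[i ai0]; have /intrP[z az] := ia i.
have z0 : (0 < `|z|)%N by rewrite az intr_eq0 -absz_gt0 in ai0.
exists (2 * `|z|)%:R^-1; split.
  exists (2 * `|z|)%N; first by rewrite muln_gt0.
  by rewrite scalerA mulfV ?scale1r// pnatr_eq0 -lt0n muln_gt0.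
move=> /(_ i)/intrP[t]; rewrite mxE az => zt.
have : z = t * (2 * `|z|)%N.
  apply: (@intr_inj R); rewrite intrM -zt -pmulrn mulrC mulVKf//.
  by rewrite pnatr_eq0 -lt0n muln_gt0.
move=> /(congr1 absz); rewrite abszM/= mulnA -[LHS]mul1n => /eqP.
by rewrite eqn_pmul2r//; lia.
Qed.

Lemma dirichlet_approximation v (e : R) : 0 < e ->
  exists k m, [/\ (0 < k)%N, integral_vector m & `|k%:R *: v - m| < e].
Proof.
move=> e0.
pose m j : 'rV[R]_n := \row_i (Num.floor (j%:R * v 0 i))%:~R.
pose u j : 'rV[R]_n := j%:R *: v - m j.
pose box : set 'rV[R]_n := [set w | forall i, w ord0 i \in `[(0 : R), 1]].
have cbox : compact box.
  apply: (@rV_compact _ _ (fun=> `[(0 : R), 1]%classic)) => _.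
  exact: segment_compact.
have box_u j : box (u j).
  move=> i; rewrite /u /m !mxE in_itv/=.
  by have := floor_itv (j%:R * v 0 i); rewrite intrD; lra.
have [l _ lP] := compact_seq_cluster cbox box_u.
have e20 : 0 < e / 2 by rewrite divr_gt0.
have [j1 _ lj1] := lP _ 0%N e20.
have [j2 j12 lj2] := lP _ j1.+1 e20.
exists (j2 - j1)%N, (m j2 - m j1); split.
- by rewrite subn_gt0.
- by move=> i; rewrite !mxE rpredB// intr_int.
- have -> : (j2 - j1)%:R *: v - (m j2 - m j1) = (u j2 - l) - (u j1 - l).
    rewrite natrB; last exact: ltnW.
    by rewrite /u scalerBl; apply/matrixP => x y; rewrite !mxE; ring.
  by apply: le_lt_trans (ler_normB _ _) _; lra.
Qed.

Lemma closed_subgroup_torsion H a :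
  closed H -> additive_subgroup H -> (forall b, integral_vector b -> H b) ->
  H a -> ~ integral_vector a ->
  exists t, [/\ H t, torsion_vector t & ~ integral_vector t].
Proof.
move=> cH sH HZ Ha nia.
have [V [e [e0 HV Ve]]] := closed_subgroup_subspace cH sH.
have approx b (d : R) : H b -> 0 < d -> exists k m, [/\ (0 < k)%N,
    integral_vector m, `|k%:R *: b - m| < d & (k%:R *: b - m <= V)%MS].
  move=> Hb d0; have de0 : 0 < Num.min d e by rewrite lt_min d0.
  have [k [m [k0 im]]] := dirichlet_approximation b de0.
  rewrite lt_min => /andP[kd ke]; exists k, m; split => //.
  apply: Ve ke; apply: sH.2; last exact: HZ.
  by rewrite scaler_nat; exact: (additive_subgroupMz k sH Hb).
have [V0|/rowV0Pn[v vV v0]] := eqVneq V 0.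
  have [k [m [k0 im _]]] := approx a 1 Ha ltr01.
  rewrite V0 submx0 subr_eq0 => /eqP kam.
  by exists a; split => //; exists k; rewrite ?kam.
pose w := `|v|^-1 *: v.
have wV : (w <= V)%MS by exact: scalemx_sub.
have [k [m [k0 im kwm kwmV]]] := approx w 1 (HV _ wV) ltr01.
have m0 : m != 0.
  apply: contraTneq kwm => ->.
  by rewrite subr0 normrZ normfZV// mulr1 normr_nat -leNgt ler1n.
have mV : (m <= V)%MS.
  by rewrite -[m](subKr (k%:R *: w)) addmx_sub ?eqmx_opp// scalemx_sub.
have [s [ts nis]] := integral_line_torsion im m0.
by exists (s *: m); split => //; apply: HV; exact: scalemx_sub.
Qed.

End ClosedSubgroups.

(** * Manifolds *)

Section Charts.
Variables (R : realType) (V : normedModType R) (M : topologicalType).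
Variable A : atlas V M.
Hypothesis mA : is_manifold A.
Implicit Type i : chart A.

Lemma manifold_hausdorff : hausdorff_space M.
Proof. by have [] := mA. Qed.

Lemma chart_exists p : exists i, dom i p.
Proof. by have [] := mA. Qed.

Lemma open_dom i : open (dom i).
Proof. by have [_ _ _ /(_ i)[]] := mA. Qed.

Lemma paramK i p : dom i p -> param i (coord i p) = p.
Proof. by have [_ _ _ /(_ i)[_ _ K _ _] _] := mA; exact: K. Qed.

Lemma coordK i x : coord_range i x -> coord i (param i x) = x.
Proof. by move=> [p ip <-]; rewrite paramK. Qed.

Lemma param_dom i x : coord_range i x -> dom i (param i x).
Proof. by move=> [p ip <-]; rewrite paramK. Qed.

Lemma near_dom i p : dom i p -> \forall q \near p, dom i q.
Proof. by move=> ip; exact: open_nbhs_nbhs (conj (open_dom i) ip). Qed.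

Lemma near_coord i p (B : set V) : dom i p ->
  (\forall x \near coord i p, B x) ->
  \forall q \near p, dom i q /\ B (coord i q).
Proof.
move=> ip Bp; have [_ _ _ /(_ i)[_ _ _ ccoord _] _] := mA.
exact: filterI (near_dom ip) (ccoord p ip _ Bp).
Qed.

Lemma near_param i p (B : set M) : dom i p -> (\forall q \near p, B q) ->
  \forall x \near coord i p, coord_range i x /\ B (param i x).
Proof.
move=> ip Bp; have [_ _ _ /(_ i)[_ open_range _ _ cparam] _] := mA.
have ix : coord_range i (coord i p) by exists p.
apply: filterI (open_nbhs_nbhs (conj open_range ix)) _.
by apply: cparam ix _ _; rewrite paramK.
Qed.

Lemma open_param_preimage i (O : set M) : open O ->
  open [set x | coord_range i x /\ O (param i x)].
Proof.
move=> oO; rewrite openE => _ [[p ip <-]]; rewrite paramK// => Op.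
by apply: near_param => //; exact: open_nbhs_nbhs.
Qed.

End Charts.

Section ManifoldBaire.
Variables (R : realType) (V : completeNormedModType R) (M : topologicalType).
Variable A : atlas V M.
Hypothesis mA : is_manifold A.

Lemma dense_coord_preimage (i : chart A) (U : set M) : dense U ->
  dense ([set x | coord_range i x /\ U (param i x)] `|`
         ~` closure (coord_range i)).
Proof.
move=> dU D [y Dy] oD.
have [[z [Dz iz]]|disj] := pselect (D `&` coord_range i !=set0); last first.
  exists y; split => //; right.
  move=> /(_ D (open_nbhs_nbhs (conj oD Dy)))[z [iz Dz]].
  by apply: disj; exists z.
have : \forall q \near param i z, dom i q /\ D (coord i q).
  apply: (near_coord mA); first exact: (param_dom mA).
  by rewrite (coordK mA)//; exact: open_nbhs_nbhs.
move=> /(dense_nbhs dU)[q Uq [iq Dq]].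
exists (coord i q); split => //; left; split; first by exists q.
by rewrite (paramK mA).
Qed.

Lemma manifold_Baire (U : (set M)^nat) :
  (forall k, open (U k) /\ dense (U k)) -> dense (\bigcap_k U k).
Proof.
move=> odU O [p Op] oO; have [i ip] := chart_exists mA p.
pose F k := [set x | coord_range i x /\ U k (param i x)] `|`
  ~` closure (coord_range i).
have odF k : open (F k) /\ dense (F k).
  split; last by apply: dense_coord_preimage; exact: (odU k).2.
  apply: openU; first by apply: (open_param_preimage mA); exact: (odU k).1.
  exact/closed_openC/closed_closure.
have [| |x [[ix Ox] Fx]] :=
    Baire odF (O := [set x | coord_range i x /\ O (param i x)]).
- by exists (coord i p); split; [exists p|rewrite (paramK mA)].
- exact: (open_param_preimage mA).
exists (param i x); split => // k _.
by have [[]|/(_ (subset_closure ix))] := Fx k I.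
Qed.

Lemma manifold_Baire_countable I (D : set I) (U : I -> set M) : countable D ->
  (forall a, D a -> open (U a) /\ dense (U a)) ->
  dense (\bigcap_(a in D) U a).
Proof.
move=> /pfcard_geP[->|[g]] odU.
  by rewrite bigcap_set0 => O O0 _; rewrite setIT.
have -> : \bigcap_(a in D) U a = \bigcap_k U (g k).
  apply/seteqP; split => p Up.
    by move=> k _; apply: Up; exact: funS.
  by move=> a /(@surj _ _ _ _ g)[k _ <-]; exact: Up.
by apply: manifold_Baire => k; apply: odU; exact: funS.
Qed.

End ManifoldBaire.

Section FiniteOrder.
Variables (R : realType) (d : nat) (M : topologicalType).
Variable A : atlas 'rV[R]_d M.
Hypothesis mA : is_manifold A.

Lemma near_iter_chart (phi : M -> M) (i : chart A) q k :
  continuous phi -> phi q = q -> dom i q ->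
  \forall p \near q,
    iter k (coord i \o phi \o param i) (coord i p) = coord i (iter k phi p).
Proof.
move=> cphi qq iq; elim: k => [|k IH]; first exact: nearW.
have cphik := cvg_iter_fixed k (cphi q) qq.
apply: filterS2 IH (cphik _ (near_dom mA iq)) => p /= -> ikp.
by rewrite /= (paramK mA).
Qed.

Lemma finite_order_fixed_interior_closed (phi : M -> M) m :
  smooth_map A A setT phi -> (0 < m)%N -> (forall p, iter m phi p = p) ->
  closed [set p | phi p = p]°.
Proof.
move=> sphi m0 phim q clq.
have cphi : continuous phi by move=> p; have [] := sphi p I.
have qq : phi q = q.
  apply: (closure_equalizer (g := id) (manifold_hausdorff mA) (cphi q)) => //.
  by apply: closureS clq; exact: interior_subset.
have [i iq] := chart_exists mA q.
pose g := coord i \o phi \o param i.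
have C1g : C1_at (coord i q) g.
  by apply: smooth_at_C1; have [_] := sphi q I; apply; rewrite ?qq.
have gfix : \forall x \near coord i q, g x = x.
  apply: (C1_periodic_fixed m0 C1g).
    apply: filterS (near_param mA iq (near_iter_chart m cphi qq iq)) => x [ix].
    by rewrite phim (coordK mA).
  move=> B /(near_coord mA iq)/clq[p [pfix [ip Bp]]].
  exists (coord i p); split => //.
  apply: filterS (near_param mA ip pfix) => x [ix fx].
  by rewrite /g/= fx (coordK mA).
have cphiq : \forall p \near q, dom i (phi p).
  by apply: cphi; rewrite qq; exact: near_dom.
apply: filterS2 cphiq (near_coord mA iq gfix) => p iphip [ip].
by move=> /(congr1 (param i)); rewrite /g/= !(paramK mA).
Qed.

End FiniteOrder.

(** * Density of the free locus *)

Section FreeLocus.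
Variables (R : realType) (n : nat) (N : kahlerData R n).
Variable Phi : 'rV[R]_n -> N -> N.
Hypotheses (mN : is_manifold (katlas N)) (actPhi : torus_action Phi).

Lemma iter_torus_action k a p : iter k (Phi a) p = Phi (k%:R *: a) p.
Proof.
have [P0 PD _ _] := actPhi; elim: k => [|k IH]; first by rewrite scale0r P0.
by rewrite iterS IH -PD -nat1r scalerDl scale1r.
Qed.

Lemma stabilizer_closed p : closed [set a | Phi a p = p].
Proof.
have [_ _ _ sP] := actPhi.
apply: (closed_equalizer (g := cst p) (manifold_hausdorff mN)).
  move=> a; have [cP _] := sP (a, p) I.
  apply: (@cvg_comp _ _ _ (fun b => (b, p)) _ _ (nbhs (a, p))) cP.
  exact: (cvg_pair (@cvg_id _ (nbhs a)) (@cvg_cst _ p _ (nbhs a) _)).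
exact: cst_continuous.
Qed.

Lemma stabilizer_subgroup p : additive_subgroup [set a | Phi a p = p].
Proof.
have [P0 PD _ _] := actPhi; split => [|a b /= ap bp]; first exact: P0.
by rewrite -{1}bp -PD subrK.
Qed.

Hypotheses (connN : connected [set: N]) (effPhi : effective Phi)
  (sPhi : forall a, smooth_map (katlas N) (katlas N) setT (Phi a)).

Lemma torsion_fixed_interior a : torsion_vector a -> ~ integral_vector a ->
  [set p | Phi a p = p]° = set0.
Proof.
move=> [k k0 ika] nia; apply: contrapT => /eqP/set0P fix_neq0; apply: nia.
have closed_fix : closed [set p | Phi a p = p]°.
  apply: (finite_order_fixed_interior_closed mN (sPhi a) k0) => p.
  by rewrite iter_torus_action; have [_ _ ->] := actPhi.
have fixT : [set p | Phi a p = p]° = setT.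
  apply: connN => //; exists [set p | Phi a p = p]°; rewrite ?setTI//.
  exact: open_interior.
apply: effPhi => p.
by apply: (@interior_subset _ [set p | Phi a p = p]); rewrite fixT.
Qed.

Lemma free_locus_dense : dense (free_locus Phi).
Proof.
pose D : set 'rV[R]_n := [set a | torsion_vector a /\ ~ integral_vector a].
have dense_torsion_free : dense (\bigcap_(a in D) ~` [set p | Phi a p = p]).
  apply: (manifold_Baire_countable mN).
    apply: sub_countable (@countable_torsion_vector R n).
    by apply: subset_card_le => a [].
  move=> a [ta nia]; split; last first.
    by apply: dense_setC; exact: torsion_fixed_interior.
  apply/closed_openC/(closed_equalizer (g := id) (manifold_hausdorff mN)).
    by move=> p; have [] := sPhi a (I : setT p).
  by move=> p; exact: cvg_id.
move=> O O0 oO; have [p [Op torsion_free]] := dense_torsion_free O O0 oO.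
exists p; split => // a ap; apply: contrapT => nia.
have [_ _ PZ _] := actPhi.
have [t [tp tt nit]] := closed_subgroup_torsion (@stabilizer_closed p)
  (stabilizer_subgroup p) (fun b => PZ b p) ap nia.
exact: torsion_free t (conj tt nit) tp.
Qed.

End FreeLocus.

(** * Positive definite metrics *)

Section InnerProduct.
Variable R : realType.
Implicit Type d : nat.

Lemma innerE d (A : 'M[R]_d) u v :
  inner A u v = \sum_j \sum_i u 0 i * A i j * v 0 j.
Proof.
rewrite /inner mxE; apply: eq_bigr => j _; rewrite !mxE mulr_suml.
by apply: eq_bigr.
Qed.

Lemma inner0 d (A : 'M[R]_d) v : inner A 0 v = 0.
Proof. by rewrite /inner !mul0mx mxE. Qed.

Lemma innerZ d (A : 'M[R]_d) (a b : R) u v :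
  inner A (a *: u) (b *: v) = a * b * inner A u v.
Proof. by rewrite /inner linearZ/= -!scalemxAl -scalemxAr !mxE mulrA. Qed.

Lemma inner_mxB d (A B : 'M[R]_d) u v :
  inner (A - B) u v = inner A u v - inner B u v.
Proof. by rewrite /inner mulmxBr mulmxBl !mxE. Qed.

Lemma inner_block_diag m n (A : 'M[R]_m) (B : 'M[R]_n) u u' v v' :
  inner (block_mx A 0 0 B) (row_mx u u') (row_mx v v') =
  inner A u v + inner B u' v'.
Proof.
rewrite /inner mul_row_block tr_row_mx mul_row_col !mulmx0 addr0 add0r.
by rewrite mxE.
Qed.

Lemma norm_inner_le d (A : 'M[R]_d) u v :
  `|inner A u v| <= d%:R ^+ 2 * `|A| * `|u| * `|v|.
Proof.
rewrite innerE.
apply: (@le_trans _ _ (\sum_(j < d) \sum_(i < d) `|u| * `|A| * `|v|)).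
  do 2![apply: le_trans (ler_norm_sum _ _ _) _; apply: ler_sum => ? _].
  by rewrite !normrM !ler_pM ?mulr_ge0//; exact: mx_entry_le_norm.
rewrite !sumr_const !card_ord -mulrnA -[leLHS]mulr_natl natrM -expr2.
by rewrite mulrA [`|u| * _]mulrC !mulrA.
Qed.

Lemma inner_continuous d (A : 'M[R]_d) : continuous (fun v => inner A v v).
Proof.
have -> : (fun v => inner A v v) =
    fun v => \sum_j \sum_i v 0 i * A i j * v 0 j.
  by apply/funext => v; exact: innerE.
move=> v; do 2!apply: (@cvg_fsum _ _ (nbhs v)) => ?.
by apply: cvgM; [apply: cvgMr_tmp|]; exact: coord_continuous.
Qed.

Definition posdef d (A : 'M[R]_d) : Prop := forall v, v != 0 -> 0 < inner A v v.

Lemma posdef_coercive d (A : 'M[R]_d) : posdef A ->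
  exists2 l : R, 0 < l & forall v, l * `|v| ^+ 2 <= inner A v v.
Proof.
move=> pA; pose S := [set v : 'rV[R]_d | `|v| = 1].
have [S0|S0] := pselect (S !=set0); last first.
  exists 1 => // v; have [->|v0] := eqVneq v 0.
    by rewrite normr0 expr0n mulr0 inner0.
  by exfalso; apply: S0; exists (`|v|^-1 *: v); rewrite /S/= normfZV.
have [w /set_mem/= w1 wmin] := EVT_min_rV S0 (@compact_unit_sphere R d)
  (continuous_subspaceT (@inner_continuous d A)).
exists (inner A w w); first by apply: pA; rewrite -normr_eq0 w1 oner_eq0.
move=> v; have [->|v0] := eqVneq v 0.
  by rewrite normr0 expr0n mulr0 inner0.
have /wmin : `|v|^-1 *: v \in S by rewrite inE /S/= normfZV.
rewrite innerZ -invfM -expr2.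
by rewrite ler_pdivlMl ?exprn_gt0 ?normr_gt0// mulrC.
Qed.

Lemma posdef_near d (A : 'rV[R]_d -> 'M[R]_d) x :
  {for x, continuous A} -> posdef (A x) ->
  exists2 l : R, 0 < l &
    \forall y \near x, forall v, l * `|v| ^+ 2 <= inner (A y) v v.
Proof.
move=> cA /posdef_coercive[mu mu0 muP].
pose D : R := d%:R ^+ 2 + 1.
have D0 : 0 < D by rewrite ltr_wpDl// exprn_ge0.
exists (mu / 2); first by rewrite divr_gt0.
have e0 : 0 < mu / 2 / D by rewrite !divr_gt0.
have /cvgrPdist_le/(_ _ e0) := cA; apply: filterS => y.
rewrite ler_pdivlMr// => Ay v.
have := norm_inner_le (A x - A y) v v; rewrite inner_mxB.
have : d%:R ^+ 2 * `|A x - A y| * `|v| ^+ 2 <= mu / 2 * `|v| ^+ 2.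
  apply: ler_wpM2r; first exact: sqr_ge0.
  by apply: le_trans Ay; rewrite mulrC ler_wpM2l// lerDl.
by have := muP v; rewrite expr2 !mulrA ler_norml; lra.
Qed.

(* Near x, l |v|^2 <= inner (A y) v v = 'D_v f y <= c |v| with c arbitrarily
   small. *)
Lemma critical_gradient_near d (f : 'rV[R]_d -> R) (A : 'rV[R]_d -> 'M[R]_d)
    x (e : R) :
  C1_at x f -> (forall v, 'D_v f x = 0) ->
  {for x, continuous A} -> posdef (A x) -> 0 < e ->
  \forall y \near x, forall v,
    'D_v f y = inner (A y) v v -> inner (A y) v v < e.
Proof.
move=> C1f D0 cA pA e0; have [l l0 lP] := posdef_near cA pA.
pose c := Num.min 1 (l * e / 2).
have c0 : 0 < c by rewrite lt_min ltr01 divr_gt0 ?mulr_gt0.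
have c2 : c ^+ 2 < l * e.
  have c1 : c <= 1 by rewrite ge_min lexx.
  have ce : c <= l * e / 2 by rewrite ge_min lexx orbT.
  by have := mulr_gt0 l0 e0; nra.
apply: filterS2 lP (C1_at_derive_near C1f c0) => y ly Dy v Dv.
have := ly v; have := Dy v; rewrite D0 subr0 Dv.
set q := inner _ _ _; set r := `|v|; have r0 : 0 <= r by exact: normr_ge0.
rewrite ler_norml => /andP[_ qcr] lr2.
have lrc : l * r <= c.
  have [->|rn0] := eqVneq r 0; first by rewrite mulr0 ltW.
  have rp : 0 < r by rewrite lt_def rn0.
  by rewrite -(ler_pM2r rp) -mulrA -expr2; exact: le_trans qcr.
rewrite -(ltr_pM2l l0); apply: le_lt_trans c2.
by apply: (@le_trans _ _ (l * (c * r))); [rewrite ler_pM2l|nra].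
Qed.

End InnerProduct.

(** * Covariances in an exponential family *)

Section Covariance.
Variables (R : realType) (Omega : finType).
Implicit Types (p : {ptws Omega -> R}) (X Y : Omega -> R).

Definition covar p X Y : R :=
  expect p (fun x => (X x - expect p X) * (Y x - expect p Y)).

Lemma expect_shift p (c : R) X : \sum_x p x = 1 ->
  expect p (fun x => c + X x) = c + expect p X.
Proof.
move=> p1; rewrite /expect; under eq_bigr do rewrite mulrDl.
by rewrite big_split/= -mulr_sumr p1 mulr1.
Qed.

Lemma covar_shiftl p (c : R) X Y : \sum_x p x = 1 ->
  covar p (fun x => c + X x) Y = covar p X Y.
Proof.
by move=> p1; rewrite /covar expect_shift//; apply: eq_bigr => x _; ring.
Qed.

Lemma covar_shiftr p (c : R) X Y : \sum_x p x = 1 ->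
  covar p X (fun x => c + Y x) = covar p X Y.
Proof.
by move=> p1; rewrite /covar expect_shift//; apply: eq_bigr => x _; ring.
Qed.

Lemma covarE p X Y : \sum_x p x = 1 ->
  covar p X Y = \sum_x X x * (p x * (Y x - expect p Y)).
Proof.
move=> p1; have centered : \sum_x p x * (Y x - expect p Y) = 0.
  under eq_bigr do rewrite mulrBr [_ * Y _]mulrC.
  by rewrite sumrB -mulr_suml p1 mul1r subrr.
transitivity (\sum_x X x * (p x * (Y x - expect p Y)) -
    expect p X * \sum_x p x * (Y x - expect p Y)).
  by rewrite mulr_sumr -sumrB; apply: eq_bigr => x _; ring.
by rewrite centered mulr0 subr0.
Qed.

Lemma cvg_expect T (F : set_system T) (FF : Filter F)
    (K : T -> {ptws Omega -> R}) p (X_ : T -> Omega -> R) X :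
  (forall x, X_ t x @[t --> F] --> X x) -> K t @[t --> F] --> p ->
  expect (K t) (X_ t) @[t --> F] --> expect p X.
Proof.
move=> XF Kp; apply: cvg_fsum => x; apply: cvgM (XF x) _.
exact: cvg_comp Kp (@proj_continuous _ _ x p).
Qed.

Lemma covar_continuous (T : topologicalType) (K : T -> {ptws Omega -> R}) X Y :
  continuous K -> continuous (fun t => covar (K t) X Y).
Proof.
move=> cK t; have cvg_deviation (Z : Omega -> R) x :
    Z x - expect (K s) Z @[s --> t] --> Z x - expect (K t) Z.
  apply: (@cvgB _ _ _ (nbhs t)); first exact: cvg_cst.
  by apply: (@cvg_expect _ (nbhs t)) (cK t) => y; exact: cvg_cst.
apply: (@cvg_expect _ (nbhs t)) (cK t) => x.
exact: cvgM (cvg_deviation X x) (cvg_deviation Y x).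
Qed.

Lemma covar_ge0 p X : (forall x, 0 <= p x) -> 0 <= covar p X X.
Proof.
by move=> p0; apply: sumr_ge0 => x _; rewrite mulr_ge0// -expr2 sqr_ge0.
Qed.

Lemma covar_eq0_range p X :
  prob_functions p -> covar p X X = 0 -> range X (expect p X).
Proof.
move=> [p0 p1] /eqP; rewrite psumr_eq0 => [/allP covar0|x _]; last first.
  by rewrite mulr_ge0// -expr2 sqr_ge0.
have [x px] : exists x, p x != 0.
  apply: contrapT => /forallNP no; have /eqP := p1.
  by rewrite big1 1?eq_sym ?oner_eq0// => x _; apply/eqP/negPn/negP; exact: no.
exists x => //; have := covar0 x (mem_index_enum x).
by rewrite /= mulf_eq0 (negPf px) orbF -expr2 sqrf_eq0 subr_eq0 => /eqP.
Qed.

End Covariance.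

Section ExponentialFamily.
Variables (R : realType) (n : nat) (Omega : finType) (E : expFamily R n Omega).
Implicit Types (theta u v : 'rV[R]_n) (x : Omega) (X : Omega -> R).

Definition statistic v x : R := \sum_k v 0 k * efF E k x.

Lemma affine_span_statistic X : affine_span E X ->
  exists c0 c, X = fun x => c0 + statistic c x.
Proof.
move=> [c0 [c XE]]; exists c0, (\row_k c k); apply/funext => x; rewrite XE.
by congr (_ + _); apply: eq_bigr => k _; rewrite mxE.
Qed.

Lemma statistic_linear x : linear (fun v => statistic v x : R^o).
Proof.
move=> a u w; rewrite /statistic scaler_sumr -big_split/=.
by apply: eq_bigr => k _; rewrite !mxE mulrDl -mulrA.
Qed.

Lemma statistic_differentiable x theta : differentiable (statistic^~ x) theta.
Proof. exact: linear_rV_differentiable (statistic_linear x). Qed.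

Lemma derive_statistic x theta v : 'D_v (statistic^~ x) theta = statistic v x.
Proof. exact: derive_linear_rV (statistic_linear x). Qed.

Lemma efpsiE theta :
  efpsi E theta = ln (\sum_x expR (efC E x + statistic theta x)).
Proof.
have := efP E theta; rewrite /exp_density.
under eq_bigr do rewrite expRD.
have psi0 := lt0r_neq0 (expR_gt0 (efpsi E theta)).
rewrite -mulr_suml expRN => /(canRL (mulfVK psi0)); rewrite mul1r => Z.
by rewrite /statistic Z expRK.
Qed.

Lemma partition_function_gt0 theta :
  0 < \sum_x expR (efC E x + statistic theta x).
Proof.
rewrite lt_def sumr_ge0 => [|x _]; rewrite ?expR_ge0// andbT.
apply/eqP => Z0; have := efP E theta; rewrite /exp_density.
under eq_bigr do rewrite expRD.
by rewrite -mulr_suml Z0 mul0r => /eqP; rewrite eq_sym oner_eq0.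
Qed.

Lemma efpsi_differentiable theta : differentiable (efpsi E) theta.
Proof.
have -> : efpsi E =
    @ln R \o (fun t => \sum_x (expR \o (cst (efC E x) + statistic^~ x)) t).
  by apply/funext => t; rewrite efpsiE.
apply: differentiable_comp.
  apply: differentiable_fsum => x.
  apply: (@differentiable_comp _ _ _ _ (cst (efC E x) + statistic^~ x)).
    by apply: differentiableD => //; exact: statistic_differentiable.
  exact: differentiable_expR.
apply/derivable1_diffP; apply: ex_derive.
exact: is_derive1_ln (partition_function_gt0 theta).
Qed.

Definition log_density x theta : R :=
  efC E x + statistic theta x - efpsi E theta.

Lemma densityE theta x : density E theta x = expR (log_density x theta).
Proof. by []. Qed.

Lemma log_density_differentiable x theta : differentiable (log_density x) theta.
Proof.
apply: differentiableB; last exact: efpsi_differentiable.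
by apply: differentiableD => //; exact: statistic_differentiable.
Qed.

Lemma derive_log_density_efpsi x theta v :
  'D_v (log_density x) theta = statistic v x - 'D_v (efpsi E) theta.
Proof.
have dpsi : derivable (efpsi E) theta v.
  exact/diff_derivable/efpsi_differentiable.
have dstat : derivable (statistic^~ x) theta v.
  exact/diff_derivable/statistic_differentiable.
have dC : derivable (cst (efC E x) : 'rV[R]_n -> R) theta v by [].
rewrite (_ : log_density x = cst (efC E x) + statistic^~ x - efpsi E)//.
rewrite (deriveB (derivableD dC dstat) dpsi) (deriveD dC dstat).
by rewrite derive_cst add0r derive_statistic.
Qed.

Lemma density_differentiable x theta :
  differentiable (fun t => density E t x : R) theta.
Proof.
apply: (@differentiable_comp _ _ _ _ (log_density x) expR).
  exact: log_density_differentiable.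
exact: differentiable_expR.
Qed.

Lemma derive_density x theta v : 'D_v (fun t => density E t x : R) theta =
  density E theta x * 'D_v (log_density x) theta.
Proof.
have dexp := differentiable_expR (log_density x theta).
rewrite (derive_comp v (log_density_differentiable x theta) dexp) deriveE//.
by rewrite diff1E// derive1E derive_val mulrC.
Qed.

Lemma derive_efpsi theta v :
  'D_v (efpsi E) theta = expect (density E theta) (statistic v).
Proof.
have : 'D_v (fun t => \sum_x (density E t x : R)) theta = 0.
  rewrite (_ : (fun _ => _) = cst 1) ?derive_cst//.
  by apply/funext => t; exact: efP.
rewrite derive_fsum; last by move=> x; exact: density_differentiable.
under eq_bigr do rewrite derive_density derive_log_density_efpsi mulrBr.
rewrite sumrB -mulr_suml (efP E theta) mul1r => /subr0_eq <-.
by apply: eq_bigr => x _; rewrite mulrC.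
Qed.

Lemma derive_log_density x theta v : 'D_v (log_density x) theta =
  statistic v x - expect (density E theta) (statistic v).
Proof. by rewrite derive_log_density_efpsi derive_efpsi. Qed.

Lemma expect_differentiable theta X :
  differentiable (fun t => expect (density E t) X) theta.
Proof.
apply: differentiable_fsum => x.
by apply: differentiableM => //; exact: density_differentiable.
Qed.

Lemma derive_expect theta v X : 'D_v (fun t => expect (density E t) X) theta =
  covar (density E theta) X (statistic v).
Proof.
rewrite covarE; last exact: efP.
rewrite derive_fsum => [|x]; last first.
  by apply: differentiableM => //; exact: density_differentiable.
apply: eq_bigr => x _; rewrite -derive_log_density -derive_density deriveMl//.
by apply: diff_derivable; exact: density_differentiable.
Qed.

Lemma inner_fisher theta u v : inner (fisher E theta) u v =
  covar (density E theta) (statistic u) (statistic v).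
Proof.
have dlog w x : statistic w x - expect (density E theta) (statistic w) =
    \sum_k w 0 k * 'D_(delta_mx 0 k) (log_density x) theta.
  rewrite -derive_log_density derive_coordE//.
  exact: log_density_differentiable.
have lnE x : (fun t => ln (density E t x)) = log_density x.
  by apply/funext => t; rewrite densityE expRK.
rewrite innerE /covar [in RHS]/expect.
under [RHS]eq_bigr do rewrite !dlog mulr_sumr mulr_suml.
rewrite [RHS]exchange_big; apply: eq_bigr => j _ /=.
under [RHS]eq_bigr do rewrite mulr_suml mulr_suml.
rewrite [RHS]exchange_big; apply: eq_bigr => i _ /=.
rewrite mxE /expect mulr_sumr mulr_suml; apply: eq_bigr => x _.
by rewrite !lnE; ring.
Qed.

End ExponentialFamily.

(** * The gradient of an expectation *)

Section C1Functions.
Variable R : realType.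

Definition C1_function (V : normedModType R) (M : topologicalType)
    (A : atlas V M) (f : M -> R) : Prop :=
  forall i p, dom i p -> C1_at (coord i p) (f \o param (a := A) i).

Lemma smooth_function_C1 n (N : kahlerData R n) (f : N -> R) :
  smooth_function f -> C1_function (katlas N) f.
Proof. by move=> sf i p ip; have [_ /(_ i tt ip I)/smooth_at_C1] := sf p I. Qed.

Section Composition.
Variables (V : normedModType R) (d : nat) (M M' : topologicalType).
Variables (A : atlas V M) (B : atlas 'rV[R]_d M') (h : M -> M') (f : M' -> R).
Hypotheses (mA : is_manifold A) (mB : is_manifold B).
Hypotheses (sh : smooth_map A B setT h) (C1f : C1_function B f).
Implicit Types (i : chart A) (j : chart B).

Lemma near_comp_param i j p : dom i p -> dom j (h p) ->
  \forall x \near coord i p,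
    ((f \o param j) \o (coord j \o h \o param i)) x = (f \o h \o param i) x.
Proof.
move=> ip jhp; have [ch _] := sh (I : setT p).
apply: filterS (near_param mA ip (ch _ (near_dom mB jhp))) => x [_ jhx] /=.
by rewrite (paramK mB).
Qed.

Lemma C1_function_comp : C1_function A (f \o h).
Proof.
move=> i p ip; have [j jhp] := chart_exists mB (h p).
apply: near_eq_C1_at (near_comp_param ip jhp) _.
have [_ /(_ i j ip jhp)/smooth_at_C1 C1h] := sh (I : setT p).
by apply: C1_at_comp => //=; rewrite (paramK mA)//; exact: C1f.
Qed.

Lemma derive_comp_chart i j p v : dom i p -> dom j (h p) ->
  'D_v (f \o h \o param i) (coord i p) =
  'D_('D_v (coord j \o h \o param i) (coord i p))
    (f \o param j) (coord j (h p)).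
Proof.
move=> ip jhp; have [_ /(_ i j ip jhp)/smooth_at_C1 C1h] := sh (I : setT p).
rewrite -(near_eq_derive v (near_comp_param ip jhp)).
rewrite derive_comp/= ?(paramK mA)//.
  exact: C1_at_differentiable.
exact: C1_at_differentiable (C1f jhp).
Qed.

End Composition.

Lemma critical_pointP n (N : kahlerData R n) (f : N -> R) p :
  C1_function (katlas N) f ->
  critical_point f p <-> forall i : chart (katlas N), dom i p ->
    forall v, 'D_v (f \o param i) (coord i p) = 0.
Proof.
move=> C1f; split=> crit i ip v.
  by rewrite deriveE; [exact: crit|exact: C1_at_differentiable (C1f i p ip)].
by rewrite -deriveE; [exact: crit|exact: C1_at_differentiable (C1f i p ip)].
Qed.

Lemma critical_point_comp n (N N' : kahlerData R n) (h : N -> N')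
    (f : N' -> R) p :
  is_manifold (katlas N) -> is_manifold (katlas N') ->
  smooth_map (katlas N) (katlas N') setT h -> C1_function (katlas N') f ->
  critical_point f (h p) -> critical_point (f \o h) p.
Proof.
move=> mN mN' sh C1f /(critical_pointP _ C1f) crit.
apply/critical_pointP; first exact: C1_function_comp sh C1f.
move=> i ip v; have [j jhp] := chart_exists mN' (h p).
by rewrite (derive_comp_chart mN mN' sh C1f v ip jhp); exact: crit.
Qed.

End C1Functions.

Section Quotient.
Variables (R : realType) (n : nat) (Y : 'rV[R]_n -> 'M[R]_n).
Local Open Scope quotient_scope.

Lemma qL_surjective e : exists u, qL Y u = e.
Proof. by exists (repr (e : {eq_quot lattice_equiv Y})); rewrite /qL reprK. Qed.

Lemma qL_lattice u u' : qL Y u = qL Y u' ->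
  exists2 k : 'rV[R]_n, integral_vector k & u' = tshift Y k u.
Proof. by move=> /eqquotP/asboolP. Qed.

Lemma piL_qL u : piL (qL Y u) = lsubmx u.
Proof.
have [k _ e] := @qL_lattice u (repr (qL Y u : {eq_quot lattice_equiv Y}))
  (esym (reprK _)).
by rewrite /piL e tshift_base.
Qed.

Lemma qL_continuous : continuous (qL Y).
Proof. exact: pi_continuous. Qed.

Hypothesis pY : parallel_frame Y.

Lemma parallel_frame_cst theta : Y theta = Y 0.
Proof.
apply/eqP; rewrite -subr_eq0 -normr_le0; apply: mean_value_le => t _.
have [_ dY DY] := pY (0 + t *: (theta - 0)).
by split => //; rewrite DY normr0.
Qed.

Lemma qL_locally_injective u :
  exists2 U, open U /\ set_inj U (qL Y) & U u.
Proof.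
have [Y0_unit _ _] := pY 0.
pose lattice_coord (w : 'rV[R]_(n + n)) : 'rV[R]_n := rsubmx w *m invmx (Y 0).
have lattice_coord0 : lattice_coord 0 = 0.
  by rewrite /lattice_coord linear0 mul0mx.
have clattice_coord : {for 0, continuous lattice_coord}.
  apply: linear_rV_continuous => a v w.
  by rewrite /lattice_coord linearP mulmxDl -scalemxAl.
have /cvgrPdist_lt/(_ _ ltr01)/nbhs_normP[d /= d0 dP] := clattice_coord.
exists (ball u (d / 2)); last by apply: ballxx; rewrite divr_gt0.
split; first exact: ball_open.
move=> u1 u2 /set_mem + /set_mem + /qL_lattice[k ik u2E].
rewrite -ball_normE/= => u_u1 u_u2.
have kE : k = lattice_coord (u2 - u1).
  rewrite /lattice_coord u2E /tshift addrC addKr row_mxKr parallel_frame_cst.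
  by rewrite mulmxK.
rewrite u2E (integral_vector_small ik) ?tshift0// kE.
have := dP (u2 - u1); rewrite /ball_/= lattice_coord0 !sub0r !normrN; apply.
rewrite -(subrKA u); apply: le_lt_trans (ler_normD _ _) _.
by rewrite distrC; lra.
Qed.

End Quotient.

Section Torification.
Variables (R : realType) (n : nat) (Omega : finType) (E : expFamily R n Omega).
Variables (N : kahlerData R n) (Phi : 'rV[R]_n -> N -> N).
Hypotheses (mN : is_manifold (katlas N)) (metN : is_riemannian N).
Variables (Y : 'rV[R]_n -> 'M[R]_n) (G : EL_kahler E Y -> N).
Hypothesis torG : torification_data Phi G.

Definition torus_cover (u : 'rV[R]_(n + n)) : N := G (qL Y u).

Lemma EL_chart_exists u : exists i : chart (katlas (EL_kahler E Y)),
  dom i (qL Y u : EL_kahler E Y) /\ coord i (qL Y u : EL_kahler E Y) = u.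
Proof.
have [pY _ _ _ _] := torG; have [U oU Uu] := qL_locally_injective pY u.
exists (exist _ U oU); split; first by exists u.
rewrite /=; apply: xget_unique => // y [Uy /=].
by apply: oU.2; rewrite inE.
Qed.

Lemma torus_cover_continuous : continuous torus_cover.
Proof.
have [_ [[sG _] _] _ _ _] := torG => u.
by apply: (cvg_comp _ _ (@qL_continuous _ _ Y u)); have [] := sG (qL Y u) I.
Qed.

Lemma torus_cover_free q : free_locus Phi q -> exists u, torus_cover u = q.
Proof.
have [_ _ <- _ _] := torG => -[e _ <-].
by have [u <-] := qL_surjective e; exists u.
Qed.

Lemma torus_cover_C1 u (j : chart (katlas N)) : dom j (torus_cover u) ->
  C1_at u (coord j \o torus_cover).
Proof.
move=> ju; have [_ [[sG _] _] _ _ _] := torG.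
have [i [iu iuE]] := EL_chart_exists u.
by have [_ /(_ i j iu ju)/smooth_at_C1] := sG (qL Y u) I; rewrite iuE.
Qed.

Lemma torus_cover_isometric u (j : chart (katlas N)) w :
  dom j (torus_cover u) ->
  let v := 'D_w (coord j \o torus_cover) u in
  inner (kmetric j (coord j (torus_cover u))) v v =
  inner (block_mx (fisher E (lsubmx u)) 0 0 (fisher E (lsubmx u))) w w.
Proof.
move=> ju /=; have [_ [_ iG] _ _ _] := torG.
have [i [iu iuE]] := EL_chart_exists u.
rewrite deriveE; last exact: C1_at_differentiable (torus_cover_C1 ju).
by have := iG i j (qL Y u) I iu ju w w; rewrite /tangent_map iuE.
Qed.

Variables (K : N -> {ptws Omega -> R}) (X : Omega -> R) (c0 : R) (c : 'rV[R]_n).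
Hypothesis K_cover : forall u, K (torus_cover u) = density E (lsubmx u).
Hypothesis XE : X = fun x => c0 + statistic E c x.
Variable f : N -> R.
Hypothesis C1f : C1_function (katlas N) f.
Hypothesis fE : forall q, f q = expect (K q) X.

Lemma derive_expect_cover u :
  'D_(row_mx c 0) (f \o torus_cover) u = covar (K (torus_cover u)) X X.
Proof.
have lin_lsubmx : linear (fun z : 'rV[R]_(n + n) => lsubmx z : 'rV[R]_n).
  exact: linearP.
have -> : f \o torus_cover =
    (fun t => expect (density E t) X) \o (fun z : 'rV[R]_(n + n) => lsubmx z).
  by apply/funext => z; rewrite /= fE K_cover.
rewrite derive_comp; [|exact: linear_rV_differentiable
  |exact: expect_differentiable].
rewrite (derive_linear_rV _ _ lin_lsubmx) row_mxKl derive_expect K_cover.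
by rewrite XE covar_shiftr//; exact: efP.
Qed.

(* v is the image of the real direction c of the tangent bundle. *)
Lemma expectation_gradient u (j : chart (katlas N)) : dom j (torus_cover u) ->
  let q := torus_cover u in
  exists2 v, 'D_v (f \o param j) (coord j q) = covar (K q) X X &
    inner (kmetric j (coord j q)) v v = covar (K q) X X.
Proof.
move=> ju; exists ('D_(row_mx c 0) (coord j \o torus_cover) u).
  have C1_cover := torus_cover_C1 ju.
  rewrite -derive_comp; [|exact: C1_at_differentiable|
    exact: C1_at_differentiable (C1f ju)].
  rewrite -derive_expect_cover; apply: near_eq_derive.
  have near_j : \forall u' \near u, dom j (torus_cover u').
    exact: torus_cover_continuous (near_dom mN ju).
  by apply: filterS near_j => u' ju' /=; rewrite (paramK mN).
rewrite torus_cover_isometric// inner_block_diag inner0 addr0 inner_fisher.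
by rewrite K_cover XE covar_shiftl ?covar_shiftr//; exact: efP.
Qed.

Hypotheses (cK : continuous K) (dense_free : dense (free_locus Phi)).
Hypothesis probK : forall q, prob_functions (K q).

Lemma critical_point_covar0 q : critical_point f q -> covar (K q) X X = 0.
Proof.
move=> /(critical_pointP _ C1f) crit.
apply/eqP; rewrite eq_le covar_ge0 ?andbT; last by have [] := probK q.
rewrite leNgt; apply/negP => cov_gt0; have [j jq] := chart_exists mN q.
have [/(_ j)[smetric pmetric] _] := metN.
have rq : coord_range j (coord j q) by exists q.
have cov2 : 0 < covar (K q) X X / 2 by rewrite divr_gt0.
have small_gradient := critical_gradient_near (C1f jq) (crit j jq)
  (smetric 0%N _ rq) (pmetric _ rq).2 cov2.
have large_covar : \forall q' \near q, covar (K q) X X / 2 < covar (K q') X X.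
  apply: (cvgr_gt _ (@covar_continuous _ _ _ _ X X cK q)).
  by rewrite ltr_pdivrMr// ltr_pMr// ltr1n.
have [_ /torus_cover_free[u <-] [[ju small] large]] :=
  dense_nbhs dense_free (filterI (near_coord mN jq small_gradient) large_covar).
have [v Dv gv] := expectation_gradient ju.
by have := small v; rewrite Dv gv => /(_ erefl)/(lt_trans large); rewrite ltxx.
Qed.

End Torification.

Lemma natural_extension_cover (R : realType) (n : nat) (Omega : finType)
    (E : expFamily R n Omega) (N : kahlerData R n) (Phi : 'rV[R]_n -> N -> N)
    (K : N -> {ptws Omega -> R}) : natural_extension E Phi K ->
  exists (Y : 'rV[R]_n -> 'M[R]_n) (G : EL_kahler E Y -> N),
    torification_data Phi G /\
    forall u, K (torus_cover G u) = density E (lsubmx u).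
Proof.
move=> [kappa [Y [G [torG kappaG]]] [_ _ K_kappa]]; exists Y, G; split => // u.
have [_ _ rG _ _] := torG.
by rewrite K_kappa ?kappaG ?piL_qL// -rG; exists (qL Y u).
Qed.

Theorem proposition7p4 (R : realType) (n : nat) (Omega : finType)
    (E : expFamily R n Omega)
    (N : kahlerData R n) (Phi : 'rV[R]_n -> N -> N) (J : N -> 'rV[R]_n)
    (toricN : is_kahler_toric Phi J)
    (torN : torification E Phi)
    (regN : regular N)
    (F_inj : injective (estimator E))
    (f : N -> R) (kahlerf : kahler_function f)
    (spec_f : set R) (spec_fP : is_spectrum E Phi f spec_f) :
  critical_values f `<=` spec_f.
Proof.
have [[connN _] [[mN _] metN _] [actPhi effPhi] autPhi _] := toricN.
have dense_free : dense (free_locus Phi).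
  by apply: (free_locus_dense mN) => // a; have [[]] := autPhi a.
have [K [phi [X [natK phiA affX fE ->]]]] := spec_fP.
have [c0 [c XE]] := affine_span_statistic affX.
have [Y [G [torG K_cover]]] := natural_extension_cover natK.
have [_ _ [cK clK _]] := natK; have probK q := (clK q).2.
have [_ _ [h [phiK hK] [sh _]]] : holomorphic_isometry phi.
  exact: connected_component_sub phiA.
have C1f := smooth_function_C1 kahlerf.1.
have fhE q : (f \o h) q = expect (K q) X by rewrite /= fE hK.
have C1fh := C1_function_comp mN mN sh C1f.
move=> _ [p <- crit_p]; rewrite fE; apply: covar_eq0_range => //.
apply: (critical_point_covar0 mN metN torG K_cover XE C1fh) => //.
by apply: critical_point_comp => //; rewrite phiK.
Qed.
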